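(* Let $p\ge2$. The tightness potential $TP:P_p(\mathbb{R}^d)\to\mathbb{R}$ is a regular functional on $P_p(\mathbb{R}^d)$.
   Context: $P_p(\mathbb{R}^d)$ is the set of Borel probability measures on $\mathbb{R}^d$ with finite $p$-th moment, with the $p$-Wasserstein distance $W_p$. $TP(\mu)=\iint\big[\langle x,y\rangle^2-\tfrac1d\|x\|^2\|y\|^2\big]\,d\mu(x)\,d\mu(y)$. Let $q=p/(p-1)$ and for $\gamma\in P(\mathbb{R}^d\times\mathbb{R}^d)$ let $|\gamma|_{j,r}=\big(\iint\|x_j\|^r d\gamma(x_1,x_2)\big)^{1/r}$; $P_{pq}(\mathbb{R}^d\times\mathbb{R}^d)$ is the set of $\gamma$ with $|\gamma|_{1,p}+|\gamma|_{2,q}<\infty$. For such $\gamma$ with $\pi^1_\#\gamma=\mu$ and $\nu\in P_p(\mathbb{R}^d)$, $\Gamma(\gamma,\nu)$ is the set of probability measures $\beta$ on $(\mathbb{R}^d)^3$ with $(\pi^1,\pi^2)_\#\beta=\gamma$, $\pi^3_\#\beta=\nu$; $\Gamma_0(\gamma,\nu)$ is the subset of those $\beta$ for which $(\pi^1,\pi^3)_\#\beta$ is an optimal coupling for $W_p(\mu,\nu)$; and $C_{p,\beta}(\mu,\nu)=\big(\iiint\|x_1-x_3\|^pd\beta\big)^{1/p}$. For a proper lower semicontinuous $\phi:P_p(\mathbb{R}^d)\to(-\infty,\infty]$ and $\mu$ with $\phi(\mu)<\infty$, $\gamma\in P_{pq}(\mathbb{R}^d\times\mathbb{R}^d)$ with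 $\pi^1_\#\gamma=\mu$ belongs to the extended Fréchet subdifferential $\partial_S\phi(\mu)$ if $\phi(\nu)-\phi(\mu)\ge\inf_{\beta\in\Gamma_0(\gamma,\nu)}\iiint\langle x_2,x_3-x_1\rangle\,d\beta+o(W_p(\mu,\nu))$ as $\nu\to\mu$ in $P_p$; it is a strong Fréchet subdifferential if $\phi(\nu)-\phi(\mu)\ge\iiint\langle x_2,x_3-x_1\rangle\,d\beta+o(C_{p,\beta}(\mu,\nu))$ for every $\nu$ and every $\beta\in\Gamma(\gamma,\nu)$. Such a $\phi$ is regular if whenever $\gamma_n$ are strong Fréchet subdifferentials of $\phi$ at $\mu_n$ with $\phi(\mu_n)\to\varphi\in\mathbb{R}$, $\mu_n\to\mu$ in $P_p(\mathbb{R}^d)$, $\sup_n|\gamma_n|_{2,q}<\infty$, and $\gamma_n\to\gamma$ narrowly in $P(\mathbb{R}^d\times\mathbb{R}^d)$, then $\gamma\in\partial_S\phi(\mu)$ and $\varphi=\phi(\mu)$. *)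

(* Defs.v *)
From HB Require Import structures.
From mathcomp Require Import all_boot all_order all_algebra.
From mathcomp Require Import all_classical all_reals all_analysis.

Set Implicit Arguments.
Unset Strict Implicit.
Unset Printing Implicit Defensive.
Import Order.TTheory GRing.Theory Num.Theory.
Import numFieldNormedType.Exports.
Local Open Scope classical_set_scope.
Local Open Scope ring_scope.

(* R^d is modelled as the row vectors 'rV[R]_d, with its usual (product)
   topology, equipped here with its Borel sigma-algebra (generated by the
   open sets). *)
Section borel_rV.
Variables (R : realType) (d : nat).

HB.instance Definition _ := @isMeasurable.Build
  (sigma_display (@open 'rV[R]_d)) 'rV[R]_d
  <<s (@open 'rV[R]_d) >>
  (@sigma_algebra0 _ setT (@open 'rV[R]_d))
  (@sigma_algebraC _ (@open 'rV[R]_d))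
  (@sigma_algebra_bigcup _ setT (@open 'rV[R]_d)).
End borel_rV.

Section defs.
Variables (R : realType) (d : nat).
Local Notation E := 'rV[R]_d.

Definition dotp (x y : E) : R := \sum_(i < d) x ord0 i * y ord0 i.
Definition enorm (x : E) : R := Num.sqrt (dotp x x).

Definition conj_exp (p : R) : R := p / (p - 1).

Local Open Scope ereal_scope.

Definition Pp (p : R) (mu : probability E R) : Prop :=
  \int[mu]_x ((enorm x) `^ p)%:E < +oo.

Definition coupling (mu nu : probability E R) : set (probability (E * E)%type R) :=
  [set pi | (forall A, measurable A -> pi (fst @^-1` A) = mu A) /\
            (forall B, measurable B -> pi (snd @^-1` B) = nu B)].

Definition cost (p : R) (pi : probability (E * E)%type R) : \bar R :=
  \int[pi]_z ((enorm (z.1 - z.2)) `^ p)%:E.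

Definition Wp (p : R) (mu nu : probability E R) : R :=
  (fine (ereal_inf [set cost p pi | pi in coupling mu nu])) `^ p^-1.

Definition mom1 (r : R) (g : probability (E * E)%type R) : \bar R :=
  \int[g]_z ((enorm z.1) `^ r)%:E.
Definition mom2 (r : R) (g : probability (E * E)%type R) : \bar R :=
  \int[g]_z ((enorm z.2) `^ r)%:E.

Definition Ppq (p : R) (g : probability (E * E)%type R) : Prop :=
  mom1 p g < +oo /\ mom2 (conj_exp p) g < +oo.

Definition first_marginal (g : probability (E * E)%type R) (mu : probability E R) : Prop :=
  forall A, measurable A -> g (fst @^-1` A) = mu A.

(* Gamma(gamma, nu): measures on (R^d x R^d) x R^d, coordinates ((x1,x2),x3) *)
Definition Gamma (g : probability (E * E)%type R) (nu : probability E R)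
  : set (probability ((E * E) * E)%type R) :=
  [set b | (forall A, measurable A -> b (fst @^-1` A) = g A) /\
           (forall B, measurable B -> b (snd @^-1` B) = nu B)].

(* cost of the coupling (pi^1,pi^3)_# beta *)
Definition cost13 (p : R) (b : probability ((E * E) * E)%type R) : \bar R :=
  \int[b]_x ((enorm (x.1.1 - x.2)) `^ p)%:E.

(* Gamma_0(gamma, nu): (pi^1,pi^3)_# beta is an optimal coupling for W_p(mu,nu) *)
Definition Gamma0 (p : R) (mu : probability E R) (g : probability (E * E)%type R)
  (nu : probability E R) : set (probability ((E * E) * E)%type R) :=
  [set b | Gamma g nu b /\
           (forall pi, coupling mu nu pi -> cost13 p b <= cost p pi)].

Definition Cpb (p : R) (b : probability ((E * E) * E)%type R) : R :=
  (fine (cost13 p b)) `^ p^-1.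

Definition pairing (b : probability ((E * E) * E)%type R) : \bar R :=
  \int[b]_x (dotp x.1.2 (x.2 - x.1.1))%:E.

Definition ext_frechet_subdiff (p : R) (phi : probability E R -> \bar R)
  (mu : probability E R) (g : probability (E * E)%type R) : Prop :=
  Pp p mu /\ phi mu < +oo /\ Ppq p g /\ first_marginal g mu /\
  forall eps : R, (0 < eps)%R -> exists delta : R, (0 < delta)%R /\
    forall nu, Pp p nu -> (Wp p mu nu < delta)%R ->
      ereal_inf [set pairing b | b in Gamma0 p mu g nu] - (eps * Wp p mu nu)%:E
        <= phi nu - phi mu.

Definition strong_frechet_subdiff (p : R) (phi : probability E R -> \bar R)
  (mu : probability E R) (g : probability (E * E)%type R) : Prop :=
  Pp p mu /\ phi mu < +oo /\ Ppq p g /\ first_marginal g mu /\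
  forall eps : R, (0 < eps)%R -> exists delta : R, (0 < delta)%R /\
    forall nu, Pp p nu -> forall b, Gamma g nu b -> (Cpb p b < delta)%R ->
      pairing b - (eps * Cpb p b)%:E <= phi nu - phi mu.

Definition proper_lsc (p : R) (phi : probability E R -> \bar R) : Prop :=
  (forall mu, Pp p mu -> -oo < phi mu) /\
  (exists mu, Pp p mu /\ phi mu < +oo) /\
  (forall mu, Pp p mu -> forall a : R, a%:E < phi mu ->
     exists delta : R, (0 < delta)%R /\
       forall nu, Pp p nu -> (Wp p mu nu < delta)%R -> a%:E < phi nu).

Definition narrow_cvg (gs : nat -> probability (E * E)%type R)
  (g : probability (E * E)%type R) : Prop :=
  forall f : (E * E)%type -> R, continuous f ->
    (exists M : R, forall z, (`|f z| <= M)%R) ->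
    (fun n => \int[gs n]_z (f z)%:E) @ \oo --> \int[g]_z (f z)%:E.

Definition regular (p : R) (phi : probability E R -> \bar R) : Prop :=
  proper_lsc p phi /\
  forall (mus : nat -> probability E R) (gs : nat -> probability (E * E)%type R)
         (mu : probability E R) (g : probability (E * E)%type R) (vphi : R),
    (forall n, strong_frechet_subdiff p phi (mus n) (gs n)) ->
    (fun n => phi (mus n)) @ \oo --> vphi%:E ->
    (forall n, Pp p (mus n)) -> Pp p mu ->
    (fun n => Wp p (mus n) mu) @ \oo --> 0%R ->
    (exists M : R, forall n, mom2 (conj_exp p) (gs n) <= M%:E) ->
    narrow_cvg gs g ->
    ext_frechet_subdiff p phi mu g /\ vphi%:E = phi mu.

Definition TP (mu : probability E R) : \bar R :=
  \int[mu]_x \int[mu]_y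
    ((dotp x y) ^+ 2 - (d%:R)^-1 * (enorm x) ^+ 2 * (enorm y) ^+ 2)%:E.

End defs.

(* Main.v *)
(** TP(mu) is a quadratic form in the second moment matrix S of mu. Moving a
    random vector X of law mu to X + H changes TP by E<A X, H> + O(E|H|^2) with
    A = 4 (S - (tr S / d) I), so testing a strong subdifferential g at mu against
    the bounded displacement t w / (1 + |w|^2), w = x2 - A x1, forces x2 = A x1
    g-almost everywhere. The matrix S is continuous for W_p since p >= 2, hence
    the integral of |x2 - A x1|^2 / (1 + |x2 - A x1|^2) passes to narrow limits
    and the limit plan is again carried by the graph of A; its first marginal is
    identified with Lipschitz test functions. The extended subdifferential
    inequality then follows from the same expansion along an optimal coupling,
    which Gamma_0 turns into a competitor; optimal couplings exist because the
    ultralimit of a minimizing sequence of couplings is countably additive on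
    Borel rectangles, by regularity of the marginals, and the cost is lower
    semicontinuous. *)
Require Import Defs.
From HB Require Import structures.
From mathcomp Require Import all_boot all_order all_algebra.
From mathcomp Require Import all_classical all_reals all_analysis.
From mathcomp Require Import measurable_realfun ring lra.
Set Implicit Arguments.
Unset Strict Implicit.
Unset Printing Implicit Defensive.
Import Order.TTheory GRing.Theory Num.Theory.
Import numFieldNormedType.Exports.
Local Open Scope classical_set_scope.
Local Open Scope ring_scope.
(** * Euclidean geometry and Borel maps *)

(** The second component of a plan only has a finite moment of order q, with 1 <= q <= 2, so w need
    not be an admissible displacement and |w|^2 need not be integrable. Saturation repairs both. The
    displacement has norm at most t, so the perturbed measure stays in P_p at cost at most t^p, and
    its first-order gain, t times the integral of |w|^2 / (1 + |w|^2), is compared with a remainder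
    of TP of order t^2. The same integrand is bounded and continuous, hence a legitimate narrow test
    function. As A varies along the sequence, the test function is frozen at the limit matrix; the
    error of this replacement involves only |x1|^2, hence only first marginals. Transport estimates
    are stated for random vectors X, Y on an arbitrary probability space, with e > 0 any upper bound
    of the p-th root of the cost. One statement thus serves the perturbation of a plan, an optimal
    plan read in either direction, and costs that vanish. *)

Section euclidean.
Variables (R : realType) (d : nat).
Local Notation E := 'rV[R]_d.
Implicit Types x y z : E.

Lemma dotpC x y : dotp x y = dotp y x.
Proof. by apply: eq_bigr => i _; rewrite mulrC. Qed.

Lemma dotpDl x y z : dotp (x + y) z = dotp x z + dotp y z.
Proof. by rewrite -big_split; apply: eq_bigr => i _; rewrite mxE mulrDl. Qed.

Lemma dotpZl a x y : dotp (a *: x) y = a * dotp x y.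
Proof. by rewrite mulr_sumr; apply: eq_bigr => i _; rewrite mxE mulrA. Qed.

Lemma dotpDr x y z : dotp x (y + z) = dotp x y + dotp x z.
Proof. by rewrite dotpC dotpDl !(dotpC _ x). Qed.

Lemma dotpZr a x y : dotp x (a *: y) = a * dotp x y.
Proof. by rewrite dotpC dotpZl dotpC. Qed.

Lemma dotpNl x y : dotp (- x) y = - dotp x y.
Proof. by rewrite -scaleN1r dotpZl mulN1r. Qed.

Lemma dotpNr x y : dotp x (- y) = - dotp x y.
Proof. by rewrite dotpC dotpNl dotpC. Qed.

Lemma dotp0l x : dotp 0 x = 0.
Proof. by rewrite -(scale0r 0) dotpZl mul0r. Qed.

Lemma dotp_ge0 x : 0 <= dotp x x.
Proof. by apply: sumr_ge0 => i _; rewrite -expr2 sqr_ge0. Qed.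

Lemma dotp_eq0 x : dotp x x = 0 -> x = 0.
Proof.
move=> /eqP; rewrite psumr_eq0; last by move=> i _; rewrite -expr2 sqr_ge0.
move=> /allP h; apply/rowP => i; rewrite mxE.
have /implyP/(_ isT) := h i (mem_index_enum i).
by rewrite mulf_eq0 orbb => /eqP.
Qed.

Lemma enorm_ge0 x : 0 <= enorm x.
Proof. exact: sqrtr_ge0. Qed.

Lemma enorm_sqr x : enorm x ^+ 2 = dotp x x.
Proof. by rewrite sqr_sqrtr ?dotp_ge0. Qed.

Lemma enorm0 : enorm (0 : E) = 0.
Proof. by rewrite /enorm dotp0l sqrtr0. Qed.

Lemma enormN x : enorm (- x) = enorm x.
Proof. by rewrite /enorm dotpNl dotpNr opprK. Qed.

Lemma enorm_distC x y : enorm (x - y) = enorm (y - x).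
Proof. by rewrite -enormN opprB. Qed.

Lemma coord_le_enorm x i : `|x ord0 i| <= enorm x.
Proof.
rewrite -(@ler_pXn2r _ 2) ?nnegrE ?enorm_ge0 ?normr_ge0//.
rewrite enorm_sqr real_normK ?num_real// /dotp (bigD1 i)//= -expr2 lerDl.
by apply: sumr_ge0 => j _; rewrite -expr2 sqr_ge0.
Qed.

Lemma coord_sqr_le x i : x ord0 i ^+ 2 <= dotp x x.
Proof.
by rewrite -enorm_sqr -[leLHS]real_normK ?num_real// ler_pXn2r
  ?nnegrE ?enorm_ge0 ?normr_ge0// coord_le_enorm.
Qed.

Lemma enormZ a x : enorm (a *: x) = `|a| * enorm x.
Proof. by rewrite /enorm dotpZl dotpZr mulrA -expr2 sqrtrM ?sqr_ge0// sqrtr_sqr. Qed.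

(** Cauchy-Schwarz: the squared norm of [dotp y y *: x - dotp x y *: y] equals [dotp y y] times the
    discriminant. *)
Lemma dotp_le_enorm x y : dotp x y <= enorm x * enorm y.
Proof.
have [y0|y0] := eqVneq (dotp y y) 0.
  by rewrite (dotp_eq0 y0) dotpC dotp0l enorm0 mulr0.
have s0 : 0 < dotp y y by rewrite lt_neqAle eq_sym y0 dotp_ge0.
have := dotp_ge0 (dotp y y *: x - dotp x y *: y).
rewrite !(dotpDl, dotpDr, dotpNl, dotpNr, dotpZl, dotpZr) (dotpC y x).
move=> h; have : 0 <= dotp y y * (dotp y y * dotp x x - dotp x y ^+ 2).
  by apply: (le_trans h); rewrite le_eqVlt; apply/orP; left; apply/eqP; ring.
rewrite pmulr_rge0// subr_ge0 => {}h.
apply: (le_trans (ler_norm _)).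
rewrite -(@ler_pXn2r _ 2) ?nnegrE ?mulr_ge0 ?enorm_ge0 ?normr_ge0//.
by rewrite real_normK ?num_real// exprMn !enorm_sqr mulrC.
Qed.

Lemma ler_enormD x y : enorm (x + y) <= enorm x + enorm y.
Proof.
rewrite -(@ler_pXn2r _ 2) ?nnegrE ?addr_ge0 ?enorm_ge0//.
rewrite enorm_sqr !(dotpDl, dotpDr) (dotpC y x) sqrrD !enorm_sqr.
have := dotp_le_enorm x y; lra.
Qed.

Lemma dotpDD_le x y : dotp (x + y) (x + y) <= 2 * dotp x x + 2 * dotp y y.
Proof.
have := dotp_ge0 (x - y).
rewrite !(dotpDl, dotpDr, dotpNl, dotpNr) (dotpC y x); lra.
Qed.

(** The norm of the sum is at most twice the larger norm. The constant is crude, but only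
    integrability is drawn from it. *)
Lemma enormD_powR_le (p : R) x y : 0 <= p ->
  enorm (x + y) `^ p <= 2 `^ p * (enorm x `^ p + enorm y `^ p).
Proof.
move=> p0; wlog h : x y / enorm x <= enorm y.
  move=> H; have [/H//|/ltW/H] := leP (enorm x) (enorm y).
  by rewrite addrC (addrC (_ `^ _)).
apply: (@le_trans _ _ ((2 * enorm y) `^ p)).
  apply: ge0_ler_powR; rewrite ?nnegrE ?enorm_ge0 ?mulr_ge0 ?enorm_ge0//.
  by apply: (le_trans (ler_enormD _ _)); lra.
rewrite powRM ?enorm_ge0// ler_wpM2l ?powR_ge0//.
by rewrite lerDr powR_ge0.
Qed.

End euclidean.

(** * Borel measurability of vector-valued maps *)

Section borel.
Variables (R : realType) (d : nat).
Local Notation E := 'rV[R]_d.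

Lemma open_measurable_rV (U : set E) : open U -> measurable U.
Proof. exact: sub_sigma_algebra. Qed.

Lemma closed_measurable_rV (F : set E) : closed F -> measurable F.
Proof.
by move=> cF; rewrite -[F]setCK; apply: measurableC; apply: open_measurable_rV;
  rewrite openC.
Qed.

Lemma continuous_measurable_rV (f : E -> R) : continuous f -> measurable_fun setT f.
Proof.
move=> cf; apply: (measurability _ (RGenOpens.measurableE R)) => _ [_ [a [b ->]] <-].
rewrite setTI; apply: open_measurable_rV; move/continuousP: cf; apply.
exact: interval_open.
Qed.

Lemma measurable_coord i : measurable_fun setT (fun x : E => x ord0 i).
Proof. by apply: continuous_measurable_rV; exact: coord_continuous. Qed.

(** Cubes with rational centre and radius 1/(n+1): a countable base of the topology. It links the
    sigma-algebra of open sets to coordinates, and later provides the cells of the step functions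
    below the cost. *)
Definition rat_box (q : 'rV[rat]_d) (n : nat) : set E :=
  [set y | forall i, `|ratr (q ord0 i) - y ord0 i| < n.+1%:R^-1].

Lemma open_bigcup_rat_box (U : set E) : open U ->
  U = \bigcup_(qn in [set qn | rat_box qn.1 qn.2 `<=` U]) rat_box qn.1 qn.2.
Proof.
rewrite openE => oU; apply/seteqP; split; last by move=> y [qn /=]; apply.
move=> x /oU /nbhs_ballP[e /= e0 eU].
(* Half of [e], because both [x] and [y] lie within [r] of the rational centre. *)
have [n rP r0] : exists2 n, (n.+1%:R^-1 : R) < e / 2 & (0 : R) < n.+1%:R^-1.
  have [n _ nP] := near_infty_natSinv_lt (PosNum (divr_gt0 e0 (ltr0n R 2))).
  by exists n; [exact: (nP n (leqnn n))|rewrite invr_gt0].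
set r := (n.+1%:R^-1 : R) in rP r0.
have qP (i : 'I_d) : exists q : rat, `|ratr q - x ord0 i| < r.
  have /rat_in_itvoo[q] : x ord0 i - r < x ord0 i + r by lra.
  rewrite in_itv/= => /andP[q1 q2]; exists q.
  by rewrite ltr_norml; lra.
have [q qx] := choice qP.
exists (\row_i q i, n); last by move=> i; rewrite mxE; exact: qx.
move=> y yP; apply: eU; split => // i j; rewrite (ord1 i) /ball/=.
have := yP j; rewrite /= mxE -/r => yj; have xj := qx j.
move: yj xj; rewrite !ltr_norml; lra.
Qed.

Lemma measurable_preimage_rat_box d' (T : measurableType d') (f : T -> E) q n :
  (forall i, measurable_fun setT (fun x => f x ord0 i)) ->
  measurable (f @^-1` rat_box q n).
Proof.
move=> mf; rewrite [X in measurable X](_ : _ = \bigcap_(i in [set: 'I_d])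
   [set x | `|ratr (q ord0 i) - f x ord0 i| < n.+1%:R^-1]); last first.
  by apply/seteqP; split=> x /= h i; [move=> _|]; exact: h.
apply: fin_bigcap_measurable => // i _.
have mi : measurable_fun setT (fun x => `|ratr (q ord0 i) - f x ord0 i| : R).
  by apply: measurableT_comp => //; apply: measurable_funB => //; exact: measurable_cst.
rewrite (_ : mkset _ = setT `&` (fun x => `|ratr (q ord0 i) - f x ord0 i|) @^-1`
  `]-oo, n.+1%:R^-1[%classic); first exact: mi.
by rewrite setTI; apply/seteqP; split=> x /=; rewrite in_itv.
Qed.

(** Open sets are countable unions of rational boxes, and the preimage of a box is a finite
    intersection of conditions on single coordinates. *)
Lemma measurable_fun_rV d' (T : measurableType d') (f : T -> E) :
  (forall i, measurable_fun setT (fun x => f x ord0 i)) -> measurable_fun setT f.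
Proof.
move=> mf; apply: (measurability (@open E)) => //.
move=> _ [U oU <-].
rewrite setTI (open_bigcup_rat_box oU) preimage_bigcup bigcup_mkcond.
apply: countable_bigcupT_measurable => [|[q n]]; first exact: countableP.
by case: ifP => // _; exact: measurable_preimage_rat_box.
Qed.

Section measurable_maps.
Variables (d' : measure_display) (T : measurableType d').
Implicit Types f g : T -> E.

Lemma measurable_rV_coord f i : measurable_fun setT f ->
  measurable_fun setT (fun x => f x ord0 i).
Proof. by move=> mf; exact: (measurableT_comp (measurable_coord i)). Qed.

Lemma measurable_rVD f g : measurable_fun setT f -> measurable_fun setT g ->
  measurable_fun setT (fun x => f x + g x).
Proof.
move=> mf mg; apply: measurable_fun_rV => i.
under eq_fun do rewrite mxE.
by apply: measurable_funD; exact: measurable_rV_coord.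
Qed.

Lemma measurable_rVZ (k : T -> R) f : measurable_fun setT k ->
  measurable_fun setT f -> measurable_fun setT (fun x => k x *: f x).
Proof.
move=> mk mf; apply: measurable_fun_rV => i.
under eq_fun do rewrite mxE.
by apply: measurable_funM => //; exact: measurable_rV_coord.
Qed.

Lemma measurable_rVN f : measurable_fun setT f ->
  measurable_fun setT (fun x => - f x).
Proof.
move=> mf; under eq_fun do rewrite -scaleN1r.
by apply: measurable_rVZ => //; exact: measurable_cst.
Qed.

Lemma measurable_rVB f g : measurable_fun setT f -> measurable_fun setT g ->
  measurable_fun setT (fun x => f x - g x).
Proof. by move=> mf mg; apply: measurable_rVD => //; exact: measurable_rVN. Qed.

Lemma measurable_dotp f g : measurable_fun setT f -> measurable_fun setT g ->
  measurable_fun setT (fun x => dotp (f x) (g x)).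
Proof.
move=> mf mg; rewrite /dotp; apply: measurable_sum => i.
by apply: measurable_funM; exact: measurable_rV_coord.
Qed.

Lemma measurable_mulmx f (M : 'M[R]_d) : measurable_fun setT f ->
  measurable_fun setT (fun x => f x *m M).
Proof.
move=> mf; apply: measurable_fun_rV => i.
under eq_fun do rewrite mxE.
apply: measurable_sum => j; apply: measurable_funM; last exact: measurable_cst.
exact: measurable_rV_coord.
Qed.

Lemma measurable_enorm f : measurable_fun setT f ->
  measurable_fun setT (fun x => enorm (f x)).
Proof.
move=> mf; have ms : measurable_fun setT (@Num.sqrt R).
  by apply: continuous_measurable_fun; exact: sqrt_continuous.
exact: (measurableT_comp ms (measurable_dotp mf mf)).
Qed.

Lemma measurable_enorm_powR f p : measurable_fun setT f ->
  measurable_fun setT (fun x => enorm (f x) `^ p).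
Proof.
by move=> mf; exact: (measurableT_comp (measurable_powR p) (measurable_enorm mf)).
Qed.

End measurable_maps.

End borel.
(** * Regularity of Borel probability measures *)

Lemma compact_box (R : realType) (d : nat) (M : R) :
  compact [set v : 'rV[R]_d | forall i, v ord0 i \in `[- M, M]].
Proof.
apply: (@rV_compact _ _ (fun=> `[- M, M]%classic)).
by move=> _; apply: segment_compact.
Qed.

Section regularity.
Variables (R : realType).
Local Open Scope ereal_scope.

(** Continuity from above for the remainders, which decrease to the empty set. *)
Lemma measure_setD_bigcup_lt d (T : measurableType d) (mu : probability T R)
    (G : (set T)^nat) (e : R) : (0 < e)%R ->
  (forall n, measurable (G n)) -> nondecreasing_seq G ->
  exists N, mu (\bigcup_n G n `\` G N) < e%:E.
Proof.
move=> e0 mG ndG; pose D n := \bigcup_n G n `\` G n.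
have mUG : measurable (\bigcup_n G n) by exact: bigcupT_measurable.
have mD n : measurable (D n) by exact: measurableD.
have D0 : \bigcap_n D n = set0.
  by rewrite -subset0 => x /= h; have [[n _ Gx] _] := h 0%N I; have [] := h n I.
have : mu \o D @ \oo --> 0.
  rewrite -(measure0 mu) -D0; apply: nonincreasing_cvg_mu => //.
  - by rewrite (le_lt_trans (probability_le1 _ _)) ?ltry//.
  - by rewrite D0.
  - by move=> m n mn; apply/subsetPset => x [Ux nGx]; split => // /(subsetPset _ _ (ndG _ _ mn)).
have e0' : 0 < e%:E by rewrite lte_fin.
by move=> /(_ _ (open_ereal_lt' e0')) [N _ /(_ N (leqnn N))]; exists N.
Qed.

Variable d : nat.
Local Notation E := 'rV[R]_d.
Variable mu : probability E R.

(** Inner approximation by closed sets and outer approximation by open sets are required together,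
    so that the property is symmetric under complement and the sets having it form a
    sigma-algebra. *)
Definition closed_open_regular (A : set E) :=
  forall e : R, (0 < e)%R -> exists FU : set E * set E,
    [/\ closed FU.1, open FU.2, FU.1 `<=` A, A `<=` FU.2 &
        mu (FU.2 `\` FU.1) < e%:E].

(** The points at sup-distance at least 1/(n+1) from the complement of [U], written so that
    closedness is immediate. For open [U] they increase to [U]. *)
Definition erosion (U : set E) n := ~` \bigcup_(y in ~` U) ball y (n.+1%:R^-1 : R).

Lemma closed_erosion U n : closed (erosion U n).
Proof.
apply: open_closedC; apply: bigcup_open => y _; exact: ball_open.
Qed.

Lemma erosion_sub U n : erosion U n `<=` U.
Proof.
move=> x /= h; apply: contrapT => nUx; apply: h; exists x => //.
exact: ballxx.
Qed.

Lemma erosion_nd U : nondecreasing_seq (erosion U).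
Proof.
move=> m n mn; apply/subsetPset => x /= h [y nUy yx]; apply: h; exists y => //.
apply: le_ball yx; rewrite lef_pV2 ?posrE// ler_nat//.
Qed.

Lemma bigcup_erosion U : open U -> \bigcup_n erosion U n = U.
Proof.
move=> oU; apply/seteqP; split; first by move=> x [n _]; exact: erosion_sub.
move=> x; move: oU; rewrite openE => /[apply] /nbhs_ballP[e /= e0 eU].
have [n _ nP] := near_infty_natSinv_lt (PosNum e0).
exists n => //= -[y nUy yx]; apply: nUy; apply: eU.
apply: (@le_ball _ _ _ n.+1%:R^-1); last exact: ball_sym.
by apply: ltW; exact: (nP n (leqnn n)).
Qed.

Lemma open_regular U : open U -> closed_open_regular U.
Proof.
move=> oU e e0.
have mE n : measurable (erosion U n) by apply: closed_measurable_rV; exact: closed_erosion.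
have [N hN] := measure_setD_bigcup_lt mu e0 mE (@erosion_nd U).
exists (erosion U N, U); split => //=.
- exact: closed_erosion.
- exact: erosion_sub.
- by move: hN; rewrite bigcup_erosion.
Qed.

Lemma closed_open_regularC A : closed_open_regular A -> closed_open_regular (~` A).
Proof.
move=> rA e e0; have [[F U] /= [cF oU FA AU h]] := rA e e0.
exists (~` U, ~` F); split => //=.
- exact: open_closedC.
- exact: closed_openC.
- exact: subsetC.
- exact: subsetC.
- by rewrite setDE setCK setIC -setDE.
Qed.

Lemma closed_open_regular_bigcup (A : (set E)^nat) :
  (forall n, closed_open_regular (A n)) -> closed_open_regular (\bigcup_n A n).
Proof.
move=> rA e e0.
have e2 : (0 < e / 2)%R by rewrite divr_gt0.
(* The individual errors sum to at most [e / 2]. The other half pays for truncating the union of the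
   closed sets, since only a finite union is known to be closed. *)
have en n : (0 < e / 2 / (2 ^ n.+1)%:R)%R by rewrite divr_gt0// ltr0n expn_gt0.
have /choice[FU FUP] n := rA n _ (en n).
pose F n := (FU n).1; pose U n := (FU n).2.
have mF n : measurable (F n) by case: (FUP n) => cF *; exact: closed_measurable_rV.
have mU n : measurable (U n) by case: (FUP n) => _ oU *; exact: open_measurable_rV.
pose G n := \big[setU/set0]_(i < n) F i.
have mG n : measurable (G n) by exact: bigsetU_measurable.
have ndG : nondecreasing_seq G.
  by move=> m n mn; apply/subsetPset; exact: subset_bigsetU.
have [N hN] := measure_setD_bigcup_lt mu e2 mG ndG.
have UG : \bigcup_n G n = \bigcup_n F n.
  apply/seteqP; split => x [n _].
    by rewrite /G -bigcup_mkord => -[k _ Fx]; exists k.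
  by move=> Fx; exists n.+1 => //; rewrite /G -bigcup_mkord; exists n => /=.
exists (G N, \bigcup_n U n); split => /=.
- by apply: closed_bigsetU => i _; case: (FUP i).
- by apply: bigcup_open => i _; case: (FUP i).
- by rewrite /G -bigcup_mkord => x [k _ Fx]; exists k => //; case: (FUP k) => _ _ + _ _; apply.
- by move=> x [k _ Ax]; exists k => //; case: (FUP k) => _ _ _ + _; apply.
have sub : \bigcup_n U n `\` G N `<=`
    (\bigcup_n (U n `\` F n)) `|` (\bigcup_n G n `\` G N).
  move=> x [[k _ Ux] nG]; have [Fx|nFx] := pselect (F k x).
    by right; split => //; rewrite UG; exists k.
  by left; exists k.
have mUF : measurable (\bigcup_n (U n `\` F n)).
  by apply: bigcupT_measurable => n; exact: measurableD.
have mUG : measurable (\bigcup_n G n) by exact: bigcupT_measurable.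
have mUU : measurable (\bigcup_n U n) by exact: bigcupT_measurable.
rewrite (@le_lt_trans _ _ (mu (\bigcup_n (U n `\` F n)) +
   mu (\bigcup_n G n `\` G N)))//.
  apply: le_trans (measureU2 _ _ _); rewrite ?le_measure ?inE//.
  - exact: measurableD.
  - by apply: measurableU => //; exact: measurableD.
  - exact: measurableD.
rewrite [e]splitr EFinD lee_ltD//.
  by rewrite ge0_fin_numE// (le_lt_trans (probability_le1 _ _)) ?ltry.
apply: le_trans (epsilon_trick0 _ (ltW e2)).
apply: (@le_trans _ _ (\sum_(n <oo) mu (U n `\` F n))).
  by apply: measure_sigma_subadditive => // n; exact: measurableD.
apply: lee_nneseries => // n _; case: (FUP n) => _ _ _ _ /ltW; exact.
Qed.

Lemma measurable_regular (A : set E) : measurable A -> closed_open_regular A.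
Proof.
move: A; apply: smallest_sub; last by move=> U; exact: open_regular.
split.
- exact: open_regular open0.
- by move=> A; rewrite setTD; exact: closed_open_regularC.
- exact: closed_open_regular_bigcup.
Qed.

Lemma measurable_outer_regular (A : set E) (e : R) : measurable A -> (0 < e)%R ->
  exists U, [/\ open U, A `<=` U & mu (U `\` A) < e%:E].
Proof.
move=> mA e0; have [[F U] /= [cF oU FA AU h]] := measurable_regular mA e0.
exists U; split => //; apply: le_lt_trans h.
apply: le_measure; rewrite ?inE; [| |exact: setDS].
- by apply: measurableD => //; exact: open_measurable_rV.
- by apply: measurableD; [exact: open_measurable_rV|exact: closed_measurable_rV].
Qed.

Lemma measurable_inner_regular (A : set E) (e : R) : measurable A -> (0 < e)%R ->
  exists K, [/\ compact K, K `<=` A & mu (A `\` K) < e%:E].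
Proof.
move=> mA e0; have e2 : (0 < e / 2)%R by rewrite divr_gt0.
have [[F U] /= [cF oU FA AU h]] := measurable_regular mA e2.
have mF := closed_measurable_rV cF.
(* Cutting a closed set with growing cubes makes it compact and loses arbitrarily little mass. *)
pose box (n : nat) : set E := [set v : E | forall i, (v ord0 i \in `[- n%:R, n%:R])%R].
have cb n : compact (box n) by exact: compact_box.
have hE : hausdorff_space E by exact: norm_hausdorff.
have clb n : closed (box n) by exact: compact_closed.
have cK n : compact (F `&` box n).
  by rewrite setIC; apply: (subclosed_compact _ (cb n)) => //; exact: closedI.
have mK n : measurable (F `&` box n).
  by apply: closed_measurable_rV; apply: closedI.
have ndK : nondecreasing_seq (fun n => F `&` box n).
  move=> m n mn; apply/subsetPset; apply: setIS => x hx i; move: (hx i).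
  rewrite /= !in_itv/= => /andP[h1 h2]; have : (m%:R <= n%:R :> R)%R by rewrite ler_nat.
  by lra.
have UK : \bigcup_n (F `&` box n) = F.
  apply/seteqP; split; first by move=> x [n _ []].
  move=> x Fx; exists (Num.truncn (enorm x)).+1 => //; split => // i.
  rewrite /= in_itv/= -ler_norml (le_trans (coord_le_enorm _ _))//.
  by apply/ltW/truncnS_gt.
have [N] := measure_setD_bigcup_lt mu e2 mK ndK; rewrite UK => hN.
exists (F `&` box N); split => //; first by move=> x [/FA].
have sub : A `\` (F `&` box N) `<=` (U `\` F) `|` (F `\` (F `&` box N)).
  move=> x [Ax nx]; have [Fx|nF] := pselect (F x); [by right|left].
  by split => //; exact: AU.
have mU := open_measurable_rV oU.
rewrite (@le_lt_trans _ _ (mu (U `\` F) + mu (F `\` (F `&` box N))))//.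
  apply: le_trans (measureU2 _ _ _); rewrite ?le_measure ?inE//.
  - exact: measurableD.
  - by apply: measurableU; exact: measurableD.
  - exact: measurableD.
  - exact: measurableD.
by rewrite [e]splitr EFinD lteD.
Qed.

End regularity.
(** * Existence of optimal couplings *)

Section ultralimit.
Variables (R : realType) (U : set_system nat).
Context {ultraU : UltraFilter U}.

(** The image of an ultrafilter is an ultrafilter, and on a compact segment every ultrafilter
    converges. This replaces any extraction of subsequences. *)
Lemma ultralimit_cvg (u : nat -> R) (a b : R) : (forall n, a <= u n <= b) -> cvg (u @ U).
Proof.
move=> uab; have := @segment_compact R a b; rewrite compact_ultra.
have uU : UltraFilter (u @ U).
  split; first exact: fmap_proper_filter.
  move=> G PG sG; apply/seteqP; split => // B GB.
  have [//|UC] := in_ultra_setVsetC (u @^-1` B) ultraU.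
  have : G (B `&` ~` B) by apply: filterI => //; exact: sG.
  by rewrite setICr => G0; case: (filter_not_empty G G0).
move=> /(_ (u @ U) uU)[|l [_ ul]]; last by apply/cvg_ex; exists l.
by apply: nearW => n; rewrite /= in_itv/=.
Qed.

Lemma ultralimit_le (u v : nat -> R) : cvg (u @ U) -> cvg (v @ U) ->
  (forall n, u n <= v n) -> lim (u @ U) <= lim (v @ U).
Proof. by move=> cu cv uv; apply: ler_lim => //; exact: nearW. Qed.

End ultralimit.

(** * The semiring of measurable rectangles *)

Fact rect_display (d1 d2 : measure_display) : measure_display. Proof. exact d1. Qed.

Section rectangles.
Context d1 d2 (T1 : measurableType d1) (T2 : measurableType d2).

(** An alias with its own opaque display keeps the semiring structure apart from the product
    sigma-algebra that [T1 * T2] already carries. *)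
Definition rect_type : Type := (T1 * T2)%type.

Definition rect : set (set rect_type) :=
  [set C | exists A B, [/\ measurable A, measurable B & C = A `*` B]].

Lemma rect0 : rect set0.
Proof. by exists set0, set0; split => //; rewrite setX0. Qed.

Lemma rectI : setI_closed rect.
Proof.
move=> _ _ [A [B [mA mB ->]]] [A' [B' [mA' mB' ->]]].
exists (A `&` A'), (B `&` B'); split; [exact: measurableI|exact: measurableI|].
by apply/seteqP; split => -[x y] /= [] [? ?] [? ?].
Qed.

Lemma rectD : semi_setD_closed rect.
Proof.
move=> _ _ [A [B [mA mB ->]]] [A' [B' [mA' mB' ->]]].
(* The points that leave through the first side, then those that stay in [A'] and leave through the
   second. *)
exists [set (A `\` A') `*` B; (A `&` A') `*` (B `\` B')]; split.
- exact: finite_set2.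
- move=> _ [->|->]; [exists (A `\` A'), B|exists (A `&` A'), (B `\` B')]; split => //.
  + exact: measurableD.
  + exact: measurableI.
  + exact: measurableD.
- rewrite bigcup_setU !bigcup_set1; apply/seteqP; split => -[x y] /=.
    move=> [[Ax By] nA'B']; have [A'x|nA'x] := pselect (A' x); last by left.
    by right; split=> //; split => // B'y; exact: nA'B'.
  by case=> [[[Ax nA'x] By]|[[Ax A'x] [By nB'y]]]; split => // -[].
- move=> X Y [->|->] [->|->] //= [[x y] /= []].
  + by move=> [[Ax nA'x] By] [[_ A'x] _].
  + by move=> [[_ A'x] _] [[Ax nA'x] By].
Qed.

HB.instance Definition _ := Pointed.copy rect_type (T1 * T2)%type.
HB.instance Definition _ := isSemiRingOfSets.Build (rect_display d1 d2)
  rect_type rect0 rectI rectD.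

End rectangles.

Lemma open_setX (T1 T2 : topologicalType) (A : set T1) (B : set T2) :
  open A -> open B -> open (A `*` B).
Proof.
move=> oA oB; rewrite openE => -[x y] [/= Ax By]; exists (A, B) => //=.
by split; exact: open_nbhs_nbhs.
Qed.

Lemma compact_sequence_cover (T : topologicalType) (K : set T) (V : (set T)^nat) :
  compact K -> (forall k, open (V k)) -> K `<=` \bigcup_k V k ->
  exists N, K `<=` \big[setU/set0]_(k < N) V k.
Proof.
move=> cK oV KV; apply: contrapT => /forallNP nK.
(* If no finite union covered [K], these remainders would generate a proper filter; its cluster
   point lies in some [V k], which [D k.+1] avoids. *)
pose D N := K `\` \big[setU/set0]_(k < N) V k.
have FF : ProperFilter (filter_from setT D).
  apply: filter_from_proper; first apply: filter_from_filter; first by exists 0%N.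
    move=> m n _ _; exists (maxn m n) => // x [Kx nx].
    by split; split => // Vx; apply: nx; apply: subset_bigsetU Vx;
      rewrite ?leq_maxl ?leq_maxr.
  move=> N _; apply: contrapT => /set0P/negP/negPn/eqP D0; apply: (nK N) => x Kx.
  by apply: contrapT => nx; have : D N x by []; rewrite D0.
have [|x [Kx clx]] := cK _ FF; first by exists 0%N => // x [].
have [k _ Vx] := KV x Kx.
have [|y [[_ ny] Vy]] := clx (D k.+1) (V k) _ (open_nbhs_nbhs (conj (oV k) Vx)).
  by exists k.+1.
by apply: ny; rewrite -bigcup_mkord; exists k => /=.
Qed.

(** * The coupling obtained as an ultralimit *)

Section limit_coupling.
Variables (R : realType) (d : nat).
Local Notation E := 'rV[R]_d.
Variables (mu nu : probability E R) (pin : nat -> probability (E * E)%type R).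
Hypothesis pin_coupling : forall n, coupling mu nu (pin n).
Variable U : set_system nat.
Context {ultraU : UltraFilter U}.

Definition limit_mass (C : set (E * E)) : R := lim ((fun n => fine (pin n C)) @ U).

Lemma fine_probability01 d' (T : measurableType d') (P : probability T R) A :
  measurable A -> 0 <= fine (P A) <= 1.
Proof.
move=> mA; rewrite fine_ge0//= -lee_fin fineK ?probability_le1//.
exact: fin_num_measure.
Qed.

Lemma limit_mass_cvg C : measurable C -> cvg ((fun n => fine (pin n C)) @ U).
Proof.
by move=> mC; apply: (@ultralimit_cvg _ _ ultraU _ 0 1) => n;
  exact: fine_probability01.
Qed.

Lemma limit_mass_ge0 C : 0 <= limit_mass C.
Proof.
(* A content must be nonnegative on all sets, measurable or not. Where the ultralimit fails to
   exist, [lim] takes its default value 0. *)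
rewrite /limit_mass; have [c|/dvgP ->//] := pselect (cvg ((fun n => fine (pin n C)) @ U)).
by apply: limr_ge => //; apply: nearW => n; exact: fine_ge0.
Qed.

Lemma fine_measureD d' (T : measurableType d') (P : probability T R) A B :
  measurable A -> measurable B -> fine (P (A `|` B)) <= fine (P A) + fine (P B).
Proof.
move=> mA mB; rewrite -fineD ?fin_num_measure// fine_le ?fin_num_measure//.
- exact: measurableU.
- by rewrite fin_numD !fin_num_measure.
- exact: measureU2.
Qed.

Lemma limit_mass_sum N (F : nat -> set (E * E)) : (forall k, measurable (F k)) ->
  (fun n => \sum_(k < N) fine (pin n (F k))) @ U --> \sum_(k < N) limit_mass (F k).
Proof.
move=> mF; apply: cvg_big => [|k _]; first exact: add_continuous.
exact: limit_mass_cvg.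
Qed.

Definition limit_content (C : set (rect_type E E)) : \bar R := (limit_mass C)%:E.

Lemma rect_measurable (C : set (rect_type E E)) : measurable C ->
  @measurable _ (E * E)%type C.
Proof. by move=> [A [B [mA mB ->]]]; exact: measurableX. Qed.

Lemma limit_content_ge0 C : (0 <= limit_content C)%E.
Proof. by rewrite lee_fin limit_mass_ge0. Qed.

Lemma limit_content_semi_additive : measure_function.semi_additive limit_content.
Proof.
move=> F n mF tF mUF; have mF' k := rect_measurable (mF k).
rewrite /limit_content sumEFin; congr EFin.
apply: cvg_lim => //; rewrite (_ : (fun _ => _) =
  fun k => \sum_(i < n) fine (pin k (F i))); first exact: limit_mass_sum.
apply/funext => k; rewrite measure_bigsetU// -sum_fine// => i _.
by rewrite fin_num_measure.
Qed.

HB.instance Definition _ := isContent.Build _ (rect_type E E) R limit_content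
  limit_content_ge0 limit_content_semi_additive.

(* All couplings share their marginals, so replacing the sides of a rectangle by
   compact subsets or open supersets changes their masses uniformly little; a
   countable cover then reduces to a finite one. *)
Lemma limit_content_sigma_subadditive :
  measurable_subset_sigma_subadditive limit_content.
Proof.
move=> C F mF [A [B [mA mB CE]]] CF.
have mF' k := rect_measurable (mF k).
apply/lee_addgt0Pr => e e0.
(* Half of [e] goes to the compact shrinking of [C], shared equally by its two sides; the other half
   is spread geometrically over the [F k], each share again split between two sides. *)
have e4 : 0 < e / 2 / 2 by rewrite !divr_gt0.
have [K [cK KA hK]] := measurable_inner_regular mu mA e4.
have [L [cL LB hL]] := measurable_inner_regular nu mB e4.
have ek k : 0 < e / 2 / (2 ^ k.+1)%:R / 2 by rewrite !divr_gt0// ltr0n expn_gt0.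
(* The bound is uniform in [n]: what is added lies over [V1 \ A'] or [V2 \ B'], whose masses are
   given by [mu] and [nu]. *)
pose outer k (V : set E * set E) := [/\ open V.1, open V.2, F k `<=` V.1 `*` V.2 &
   forall n, fine (pin n (V.1 `*` V.2)) <= fine (pin n (F k)) + e / 2 / (2 ^ k.+1)%:R].
have /choice[V VP] k : exists V, outer k V.
  have [A' [B' [mA' mB' FE]]] := mF k.
  have [V1 [oV1 AV1 h1]] := measurable_outer_regular mu mA' (ek k).
  have [V2 [oV2 BV2 h2]] := measurable_outer_regular nu mB' (ek k).
  have mV1 := open_measurable_rV oV1; have mV2 := open_measurable_rV oV2.
  exists (V1, V2); split => //=; first by rewrite FE => -[x y] /= [/AV1 ? /BV2 ?].
  move=> n; have [pmu pnu] := pin_coupling n.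
  have mD1 : measurable (V1 `\` A') by exact: measurableD.
  have mD2 : measurable (V2 `\` B') by exact: measurableD.
  pose D1 := (fst @^-1` (V1 `\` A') : set (E * E)).
  pose D2 := (snd @^-1` (V2 `\` B') : set (E * E)).
  have mp1 : measurable D1 by rewrite -[D1]setTI; exact: measurable_fst.
  have mp2 : measurable D2 by rewrite -[D2]setTI; exact: measurable_snd.
  apply: (@le_trans _ _ (fine (pin n (F k `|` (D1 `|` D2))))).
    apply: fine_le; rewrite ?fin_num_measure//.
    - exact: measurableX.
    - by apply: measurableU => //; exact: measurableU.
    - apply: le_measure; rewrite ?inE; [exact: measurableX| |].
        by apply: measurableU => //; exact: measurableU.
      move=> [x y] /= [Vx Vy]; rewrite FE.
      have [A'x|nA'] := pselect (A' x); last by right; left.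
      by have [B'y|nB'] := pselect (B' y); [left|right; right].
  apply: (le_trans (fine_measureD _ _ _)) => //; first exact: measurableU.
  rewrite lerD2l; apply: (le_trans (fine_measureD _ _ _)) => //.
  rewrite /D1 /D2 pmu// pnu// [leRHS]splitr lerD// -lee_fin fineK ?fin_num_measure//;
    exact/ltW.
have [oV1 oV2] : (forall k, open (V k).1) /\ (forall k, open (V k).2).
  by split=> k; case: (VP k).
have mV k : measurable ((V k).1 `*` (V k).2).
  by apply: measurableX; exact: open_measurable_rV.
have cKL : compact (K `*` L) by exact: compact_setX.
have KLV : K `*` L `<=` \bigcup_k ((V k).1 `*` (V k).2).
  move=> [x y] /= [Kx Ly]; have /CF[k _ Fk] : C (x, y).
    by rewrite CE; split; [exact: KA|exact: LB].
  by exists k => //; case: (VP k) => _ _ + _; apply.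
have [N hN] : exists N, K `*` L `<=` \big[setU/set0]_(k < N) ((V k).1 `*` (V k).2).
  apply: (compact_sequence_cover (V := fun k => (V k).1 `*` (V k).2)) => // k.
  exact: open_setX.
have key n : fine (pin n C) <= e / 2 +
   \sum_(k < N) (fine (pin n (F k)) + e / 2 / (2 ^ k.+1)%:R).
  have [pmu pnu] := pin_coupling n.
  have mK : measurable K by apply: closed_measurable_rV; apply: compact_closed => //; exact: norm_hausdorff.
  have mL : measurable L by apply: closed_measurable_rV; apply: compact_closed => //; exact: norm_hausdorff.
  have mD1 : measurable (A `\` K) by exact: measurableD.
  have mD2 : measurable (B `\` L) by exact: measurableD.
  pose D1 := (fst @^-1` (A `\` K) : set (E * E)).
  pose D2 := (snd @^-1` (B `\` L) : set (E * E)).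
  have mp1 : measurable D1 by rewrite -[D1]setTI; exact: measurable_fst.
  have mp2 : measurable D2 by rewrite -[D2]setTI; exact: measurable_snd.
  have mKL : measurable (K `*` L) by exact: measurableX.
  apply: (@le_trans _ _ (fine (pin n ((D1 `|` D2) `|` K `*` L)))).
    apply: fine_le; rewrite ?fin_num_measure//.
    - by rewrite CE; exact: measurableX.
    - by apply: measurableU => //; exact: measurableU.
    - apply: le_measure; rewrite ?inE; [by rewrite CE; exact: measurableX| |].
        by apply: measurableU => //; exact: measurableU.
      rewrite CE => -[x y] /= [Ax By].
      have [Kx|nK] := pselect (K x); last by left; left.
      by have [Ly|nL] := pselect (L y); [right|left; right].
  apply: (le_trans (fine_measureD _ _ _)) => //; first exact: measurableU.
  apply: lerD.
    apply: (le_trans (fine_measureD _ _ _)) => //.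
    rewrite /D1 /D2 pmu// pnu// [leRHS]splitr lerD// -lee_fin fineK ?fin_num_measure//;
      exact/ltW.
  apply: (@le_trans _ _ (\sum_(k < N) fine (pin n ((V k).1 `*` (V k).2)))).
    rewrite sum_fine; last by move=> k _; rewrite fin_num_measure.
    apply: fine_le; rewrite ?fin_num_measure//.
      by apply/sum_fin_numP => k _ _; rewrite fin_num_measure.
    exact: (@content_subadditive _ _ _ (pin n) _ (fun k => (V k).1 `*` (V k).2)).
  by apply: ler_sum => k _; case: (VP k) => _ _ _; exact.
have mC : measurable (C : set (E * E)%type) by rewrite CE; exact: measurableX.
(* Only now is the ultralimit taken: [N] does not depend on [n], so it meets finite sums only. *)
have {}key : limit_mass C <= e / 2 +
    \sum_(k < N) (limit_mass (F k) + e / 2 / (2 ^ k.+1)%:R).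
  rewrite big_split/=.
  have lS := @limit_mass_sum N F mF'.
  set S := \sum_(k < N) (e / 2 / _).
  have cS : (fun n => e / 2 + (\sum_(k < N) fine (pin n (F k)) + S)) @ U -->
     e / 2 + (\sum_(k < N) limit_mass (F k) + S).
    by apply: cvgD; [exact: cvg_cst|apply: cvgD => //; exact: cvg_cst].
  rewrite -(cvg_lim _ cS)//; apply: ultralimit_le.
  - exact: limit_mass_cvg.
  - by apply/cvg_ex; eexists; exact: cS.
  - by move=> n; apply: (le_trans (key n)); rewrite big_split.
have e2 : 0 <= e / 2 by rewrite divr_ge0// ltW.
have hS : (\sum_(k < N) (e / 2 / (2 ^ k.+1)%:R)%:E <= (e / 2)%:E :> \bar R)%E.
  apply: le_trans (epsilon_trick0 xpredT e2).
  rewrite -(big_mkord xpredT (fun k => (e / 2 / (2 ^ k.+1)%:R)%:E)).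
  by apply: nneseries_lim_ge => k _ _; rewrite lee_fin divr_ge0.
have hF : (\sum_(k < N) limit_content (F k) <= \sum_(k <oo) limit_content (F k))%E.
  rewrite -(big_mkord xpredT (fun k => limit_content (F k))).
  by apply: nneseries_lim_ge => k _ _; exact: limit_content_ge0.
apply: (@le_trans _ _ (\sum_(k < N) limit_content (F k) + e%:E)%E); last by rewrite leeD2r.
move: hS; rewrite /limit_content !sumEFin !lee_fin => hS.
apply: (le_trans key); rewrite big_split/=; move: hS; lra.
Qed.

HB.instance Definition _ := Content_SigmaSubAdditive_isMeasure.Build _ R
  (rect_type E E) limit_content limit_content_sigma_subadditive.

Definition limit_measure : set (E * E) -> \bar R := measure_extension limit_content.

(** Ensures that the Caratheodory extension from rectangles is defined on exactly the product
    sigma-algebra on which couplings live. *)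
Lemma measurable_rectE :
  @measurable _ (E * E)%type = <<s @measurable _ (rect_type E E) >>.
Proof.
rewrite measurable_prod_measurableType; congr (<<s _ >>).
apply/seteqP; split => C.
  by move=> [A mA [B mB <-]]; exists A, B.
by move=> [A [B [mA mB ->]]]; exists A => //; exists B.
Qed.

Lemma limit_measureE (C : set (rect_type E E)) : measurable C ->
  limit_measure C = limit_content C.
Proof. by move=> mC; rewrite /limit_measure /measure_extension measurable_mu_extE. Qed.

Lemma limit_measure0 : limit_measure set0 = 0%E.
Proof. exact: measure0. Qed.

Lemma limit_measure_ge0 C : (0 <= limit_measure C)%E.
Proof. exact: measure_ge0. Qed.

Lemma limit_measure_semi_sigma_additive : semi_sigma_additive limit_measure.
Proof.
move=> F mF tF mUF; rewrite /limit_measure.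
apply: measure_semi_sigma_additive => //.
- by move=> k; have := mF k; rewrite measurable_rectE.
- by move: mUF; rewrite measurable_rectE.
Qed.

HB.instance Definition _ := isMeasure.Build _ (E * E)%type R limit_measure
  limit_measure0 limit_measure_ge0 limit_measure_semi_sigma_additive.

Lemma limit_measure_setX (A B : set E) : measurable A -> measurable B ->
  limit_measure (A `*` B) = (limit_mass (A `*` B))%:E.
Proof. by move=> mA mB; rewrite limit_measureE//; exists A, B. Qed.

Lemma limit_mass_fst (A : set E) : measurable A -> (limit_mass (A `*` setT))%:E = mu A.
Proof.
move=> mA; rewrite /limit_mass (_ : (fun _ => _) = cst (fine (mu A))).
  by rewrite lim_cst// fineK// fin_num_measure.
by apply/funext => n; rewrite setXT (pin_coupling n).1.
Qed.

Lemma limit_mass_snd (B : set E) : measurable B -> (limit_mass (setT `*` B))%:E = nu B.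
Proof.
move=> mB; rewrite /limit_mass (_ : (fun _ => _) = cst (fine (nu B))).
  by rewrite lim_cst// fineK// fin_num_measure.
by apply/funext => n; rewrite setTX (pin_coupling n).2.
Qed.

Lemma limit_measure_setT : limit_measure setT = 1%E.
Proof. by rewrite -setXTT limit_measure_setX// limit_mass_fst// probability_setT. Qed.

HB.instance Definition _ :=
  Measure_isProbability.Build _ _ _ limit_measure limit_measure_setT.

Lemma limit_measure_coupling : coupling mu nu limit_measure.
Proof.
split=> [A mA|B mB].
  by rewrite -setXT; apply: etrans (limit_mass_fst mA); exact: limit_measure_setX.
by rewrite -setTX; apply: etrans (limit_mass_snd mB); exact: limit_measure_setX.
Qed.

End limit_coupling.

(** * Lower semicontinuous costs along ultralimits *)

Section optimal.
Variables (R : realType) (d : nat).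
Local Notation E := 'rV[R]_d.

(** Convergence is kept for masses of rectangles only, which is what the step functions below a cost
    require. *)
Lemma limit_coupling_exists (mu nu : probability E R)
    (pin : nat -> probability (E * E)%type R) (U : set_system nat) :
  UltraFilter U -> (forall n, coupling mu nu (pin n)) ->
  exists pi : probability (E * E)%type R, coupling mu nu pi /\
    forall A B, measurable A -> measurable B ->
      (fun n => fine (pin n (A `*` B))) @ U --> fine (pi (A `*` B)).
Proof.
move=> ultraU cpin.
pose P : probability (E * E)%type R := @limit_measure _ _ _ _ _ cpin U ultraU.
exists P; split; first exact: limit_measure_coupling.
move=> A B mA mB; rewrite [P _](limit_measure_setX cpin mA mB)/=.
by apply: limit_mass_cvg; exact: measurableX.
Qed.

(** Indices that decode to no box yield the empty set, which no point meets and which therefore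
    never contributes a cell. *)
Definition box_enum (j : nat) : set E :=
  oapp (fun qn : 'rV[rat]_d * nat => rat_box qn.1 qn.2) set0 (unpickle j).

Lemma measurable_rat_box (q : 'rV[rat]_d) n : measurable (rat_box q n : set E).
Proof. by apply: (measurable_preimage_rat_box (f := id)); exact: measurable_coord. Qed.

Lemma measurable_box_enum j : measurable (box_enum j).
Proof. by rewrite /box_enum; case: unpickle => [qn|]//=; exact: measurable_rat_box. Qed.

Lemma nbhs_box_enum (x : E) (P : set E) : nbhs x P ->
  exists2 j, box_enum j x & box_enum j `<=` P.
Proof.
move=> xP; have : P° x by [].
rewrite {1}(open_bigcup_rat_box (@open_interior _ P)) => -[qn qnP qnx].
exists (pickle qn); first by rewrite /box_enum pickleK.
by rewrite /box_enum pickleK/=; apply: subset_trans qnP _; exact: interior_subset.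
Qed.

Section lsc.
Variable c : E * E -> R.
Hypothesis c_ge0 : forall z, 0 <= c z.
Hypothesis c_lsc : forall z e, 0 < e -> \forall z' \near z, c z - e < c z'.
Hypothesis c_meas : measurable_fun setT c.

(* [step k] is the largest minorant of [c] obtained from its infima on products of
   the first [k] boxes. It depends on [x] and [y] only through finite codes, so
   its integral is a finite combination of masses of rectangles. *)
Definition cell_inf i j : R := inf (c @` (box_enum i `*` box_enum j)).

Lemma cell_inf_le i j z : (box_enum i `*` box_enum j) z -> cell_inf i j <= c z.
Proof.
move=> h; apply: ge_inf; last by exists z.
by exists 0 => _ [z' _ <-].
Qed.

Lemma cell_inf_ge i j z a : (box_enum i `*` box_enum j) z ->
  (forall z', (box_enum i `*` box_enum j) z' -> a <= c z') -> a <= cell_inf i j.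
Proof.
move=> h ha; apply: lb_le_inf; first by exists (c z), z.
by move=> _ [z' h' <-]; exact: ha.
Qed.

Definition code k (x : E) : {ffun 'I_k -> bool} := [ffun j : 'I_k => x \in box_enum j].

Lemma measurable_code k s : measurable (code k @^-1` [set s]).
Proof.
rewrite (_ : _ @^-1` _ = \bigcap_(j in [set: 'I_k])
   (if s j then box_enum j else ~` box_enum j)).
  apply: fin_bigcap_measurable => // j _; case: ifP => _.
    exact: measurable_box_enum.
  by apply: measurableC; exact: measurable_box_enum.
apply/seteqP; split => x /=.
  by move=> <- j _; rewrite ffunE; case: ifPn => [/set_mem//|/negP nx] /mem_set.
move=> h; apply/ffunP => j; rewrite ffunE; have := h j I.
by case: ifP => _; [move=> /mem_set ->|move=> nx; apply/negbTE/negP => /set_mem].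
Qed.

(** Starting the maximum at 0 makes the values nonnegative, as Fatou requires, and still below [c],
    which is nonnegative. *)
Definition step_val k (s t : {ffun 'I_k -> bool}) : R :=
  \big[Num.max/0]_(ij : 'I_k * 'I_k) (if s ij.1 && t ij.2 then cell_inf ij.1 ij.2 else 0).

Definition step k (z : E * E) : R := step_val (code k z.1) (code k z.2).

Lemma step_val_ge0 k s t : 0 <= @step_val k s t.
Proof. by rewrite /step_val bigmax_idl le_max lexx. Qed.

Lemma step_le k z : step k z <= c z.
Proof.
apply: bigmax_le => // -[i j] _ /=; rewrite !ffunE.
case: ifP => // /andP[/set_mem h1 /set_mem h2]; exact: cell_inf_le.
Qed.

Lemma step_near z e : 0 < e -> \forall k \near \oo, c z - e <= step k z.
Proof.
move=> e0; have [[P Q] /= [xP yQ] PQ] := c_lsc z e0.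
have [i ix iP] := nbhs_box_enum xP; have [j jy jQ] := nbhs_box_enum yQ.
(* A code of length [k] tests the boxes of index below [k], hence the successor. *)
exists (maxn i j).+1 => // k /= hk.
have ik : (i < k)%N by rewrite (leq_ltn_trans (leq_maxl _ _) hk).
have jk : (j < k)%N by rewrite (leq_ltn_trans (leq_maxr _ _) hk).
apply: le_trans (le_bigmax _ _ (Ordinal ik, Ordinal jk)) => /=.
rewrite !ffunE/= !mem_set//=; apply: (@cell_inf_ge _ _ z) => // z' [h1 h2].
by apply/ltW/(PQ z'); split; [exact: iP|exact: jQ].
Qed.

Lemma step_cvg z : (fun k => (step k z)%:E) @ \oo --> (c z)%:E.
Proof.
apply: cvg_EFin; first exact: nearW.
apply/cvgrPdist_le => e e0; have := step_near z e0; apply: filterS => k hk.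
by rewrite ger0_norm ?subr_ge0 ?step_le// lerBlDr addrC -lerBlDr.
Qed.

Lemma step_sum k z : (step k z)%:E = (\sum_(st : {ffun 'I_k -> bool} * {ffun 'I_k -> bool})
  (step_val st.1 st.2)%:E * (\1_(code k @^-1` [set st.1] `*` code k @^-1` [set st.2]) z)%:E)%E.
Proof.
rewrite (bigD1 (code k z.1, code k z.2))//= indicE mem_set//= mule1 big1 ?adde0//.
move=> [s t] /= st; rewrite indicE memNset ?mule0// => -[/= h1 h2].
by move: st; rewrite -h1 -h2 eqxx.
Qed.

Lemma measurable_cell k (s t : {ffun 'I_k -> bool}) :
  measurable (code k @^-1` [set s] `*` code k @^-1` [set t]).
Proof. by apply: measurableX; exact: measurable_code. Qed.

Lemma measurable_step k : measurable_fun setT (fun z => (step k z)%:E).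
Proof.
under eq_fun do rewrite step_sum.
apply: emeasurable_sum => -[s t]; apply: emeasurable_funM => //.
by apply/measurable_EFinP; exact: measurable_indic (measurable_cell s t).
Qed.

Lemma integral_step k (pi : probability (E * E)%type R) :
  (\int[pi]_z (step k z)%:E)%E = (\sum_(st : {ffun 'I_k -> bool} * {ffun 'I_k -> bool})
    (step_val st.1 st.2 * fine (pi (code k @^-1` [set st.1] `*` code k @^-1` [set st.2]))))%:E.
Proof.
under eq_integral do rewrite step_sum.
have mi (st : {ffun 'I_k -> bool} * {ffun 'I_k -> bool}) : measurable_fun [set: E * E]
    (fun z => (\1_(code k @^-1` [set st.1] `*` code k @^-1` [set st.2]) z : R)%:E).
  by apply/measurable_EFinP; exact: measurable_indic (measurable_cell _ _).
rewrite ge0_integral_sum//=.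
- rewrite -sumEFin; apply: eq_bigr => st _.
  rewrite ge0_integralZl_EFin ?step_val_ge0//.
  rewrite integral_indic ?setIT//; last exact: measurable_cell.
  by rewrite EFinM fineK// fin_num_measure//; exact: measurable_cell.
- by move=> st; exact: emeasurable_funM.
- by move=> st z _; rewrite mule_ge0// lee_fin step_val_ge0.
Qed.

(** The integral of each step function is a finite combination of rectangle masses and so passes to
    the ultralimit; Fatou then recovers [c] from its steps. *)
Lemma integral_le_limit (pin : nat -> probability (E * E)%type R)
    (pi : probability (E * E)%type R) (U : set_system nat) (r : R) :
  UltraFilter U ->
  (forall A B, measurable A -> measurable B ->
      (fun n => fine (pin n (A `*` B))) @ U --> fine (pi (A `*` B))) ->
  (forall e, 0 < e -> \forall n \near U, (\int[pin n]_z (c z)%:E <= (r + e)%:E)%E) ->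
  (\int[pi]_z (c z)%:E <= r%:E)%E.
Proof.
move=> ultraU cpi cr.
have stepr k : (\int[pi]_z (step k z)%:E <= r%:E)%E.
  rewrite integral_step lee_fin; set S := (S in S <= r).
  have cS : (fun n => \sum_(st : {ffun 'I_k -> bool} * {ffun 'I_k -> bool})
    (step_val st.1 st.2 * fine (pin n (code k @^-1` [set st.1] `*` code k @^-1` [set st.2]))))
      @ U --> S.
    apply: cvg_big => [|st _]; first exact: add_continuous.
    by apply: cvgM; [exact: cvg_cst|apply: cpi; exact: measurable_code].
  apply/ler_addgt0Pr => e e0; rewrite -(cvg_lim _ cS)//.
  apply: limr_le; first by apply/cvg_ex; exists S.
  have := cr _ e0; apply: filterS => n hn.
  rewrite -lee_fin -integral_step; apply: le_trans hn.
  apply: ge0_le_integral => //.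
  - by move=> z _; rewrite lee_fin step_val_ge0.
  - exact: measurable_step.
  - exact/measurable_EFinP.
  - by move=> z _; rewrite lee_fin step_le.
have -> : (\int[pi]_z (c z)%:E = \int[pi]_z limn_einf (fun k => (step k z)%:E))%E.
  apply: eq_integral => z _; have [-> _] := cvg_limn_einf_sup (@step_cvg z).
  by [].
apply: (le_trans (fatou _ _ _ _)) => //.
- exact: measurable_step.
- by move=> k z _; rewrite lee_fin step_val_ge0.
rewrite limn_einf_lim; apply: lime_le; first exact: is_cvg_einfs.
apply: nearW => n; apply: le_trans (stepr n).
by apply: ereal_inf_lbound; exists n => /=.
Qed.

End lsc.
End optimal.

(** * Existence of minimizers of the transport cost *)

Section continuity.
Variables (R : realType) (d : nat).
Local Notation E := 'rV[R]_d.

Lemma continuous_dotp (T : topologicalType) (f g : T -> E) :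
  continuous f -> continuous g -> continuous (fun x => dotp (f x) (g x)).
Proof.
move=> cf cg x; rewrite /dotp; apply: cvg_big => [|i _]; first exact: add_continuous.
apply: cvgM.
  apply: (@continuous_comp _ _ _ f (fun v : E => v ord0 i)); first exact: cf.
  exact: coord_continuous.
apply: (@continuous_comp _ _ _ g (fun v : E => v ord0 i)); first exact: cg.
exact: coord_continuous.
Qed.

Lemma continuous_enorm (T : topologicalType) (f : T -> E) :
  continuous f -> continuous (fun x => enorm (f x)).
Proof.
move=> cf x; apply: (@continuous_comp _ _ _ (fun x => dotp (f x) (f x)) (@Num.sqrt R)).
  exact: continuous_dotp.
exact: sqrt_continuous.
Qed.

Lemma continuous_diff : continuous (fun z : E * E => z.1 - z.2).
Proof. by move=> z; apply: cvgB; [exact: cvg_fst|exact: cvg_snd]. Qed.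

Lemma powR_continuous_pos (p a : R) : 0 < a -> {for a, continuous (fun t : R => t `^ p)}.
Proof.
move=> a0; apply: differentiable_continuous; apply/derivable1_diffP.
by apply: derivable_powR; rewrite in_itv/= a0.
Qed.

Lemma cost_lsc (p : R) (z : E * E) (e : R) : 0 < p -> 0 < e ->
  \forall z' \near z, enorm (z.1 - z.2) `^ p - e < enorm (z'.1 - z'.2) `^ p.
Proof.
(* Continuity of the power is used only away from 0; where the norm vanishes, lower semicontinuity
   is just nonnegativity of the cost. *)
move=> p0 e0; have [->|n0] := eqVneq (enorm (z.1 - z.2)) 0.
  have : \forall z' \near nbhs z, True by exact: filterT.
  apply: filterS => z' _; rewrite powR0 ?gt_eqF// sub0r (lt_le_trans _ (powR_ge0 _ _))//.
  by rewrite oppr_lt0.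
have cz : (fun z' : E * E => enorm (z'.1 - z'.2) `^ p) @ z --> enorm (z.1 - z.2) `^ p.
  apply: (@continuous_comp _ _ _ (fun z' : E * E => enorm (z'.1 - z'.2)) (fun t => t `^ p)).
    by apply: continuous_enorm; exact: continuous_diff.
  by apply: powR_continuous_pos; rewrite lt_neqAle eq_sym n0 enorm_ge0.
by apply: cvgr_gt cz _ _; rewrite ltrBlDr ltrDl.
Qed.

Lemma measurable_cost (p : R) :
  measurable_fun setT (fun z : E * E => enorm (z.1 - z.2) `^ p).
Proof.
apply: measurable_enorm_powR; apply: measurable_rVB; [exact: measurable_fst|exact: measurable_snd].
Qed.

Local Open Scope ereal_scope.
Lemma product_coupling (mu nu : probability E R) : coupling mu nu (mu \x nu)%E.
Proof.
split=> [A mA|B mB].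
- have h : mu A * nu setT = mu A by rewrite probability_setT mule1.
  by rewrite -setXT -[RHS]h; exact: product_measure1E.
- have h : mu setT * nu B = nu B by rewrite probability_setT mul1e.
  by rewrite -setTX -[RHS]h; exact: product_measure1E.
Qed.

Local Close Scope ereal_scope.
Theorem optimal_coupling_exists (p : R) (mu nu : probability E R) : 0 < p ->
  exists pi, coupling mu nu pi /\
    forall pi', coupling mu nu pi' -> (cost p pi <= cost p pi')%E.
Proof.
move=> p0; pose S := [set cost p pi | pi in coupling mu nu].
have cost0 (pi : probability (E * E)%type R) : (0 <= cost p pi)%E.
  by apply: integral_ge0 => z _; rewrite lee_fin powR_ge0.
have S0 : (0 <= ereal_inf S)%E.
  by apply: le_ereal_inf_tmp => _ [pi _ <-].
have Slb pi : coupling mu nu pi -> (ereal_inf S <= cost p pi)%E.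
  by move=> cpi; apply: ereal_inf_lbound; exists pi.
(* With an infinite infimum every coupling is optimal, and the product measure shows that one
   exists. *)
have [Soo|Sfin] := eqVneq (ereal_inf S) +oo%E.
  exists (mu \x nu)%E; split; first exact: product_coupling.
  by move=> pi' /Slb; rewrite Soo leye_eq => /eqP ->; rewrite leey.
have {}Sfin : ereal_inf S \is a fin_num by rewrite ge0_fin_numE// ltey.
have e_gt0 n : 0 < (n.+1%:R^-1 : R) by rewrite invr_gt0.
have /choice[pin pinP] n : exists pi, coupling mu nu pi /\
    (cost p pi < ereal_inf S + (n.+1%:R^-1)%:E)%E.
  by have [_ [pi cpi <-] h] := lb_ereal_inf_adherent (e_gt0 n) Sfin; exists pi.
(* The ultrafilter refines [\oo], so eventual bounds along the minimizing sequence hold along it. *)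
have [U [ultraU oU]] := ultraFilterLemma (eventually_filter : ProperFilter \oo).
have [pi [cpi pilim]] := limit_coupling_exists ultraU (fun n => (pinP n).1).
exists pi; split => // pi' /Slb; apply: le_trans.
rewrite -(fineK Sfin); apply: (integral_le_limit _ _ _ ultraU pilim).
- by move=> z; exact: powR_ge0.
- by move=> z e e0; exact: cost_lsc.
- exact: measurable_cost.
move=> e e0; apply: oU; near=> n.
rewrite EFinD fineK//; apply: (le_trans (ltW (pinP n).2)).
rewrite leeD2l// lee_fin ltW//; near: n.
exact: (near_infty_natSinv_lt (PosNum e0)).
Unshelve. all: by end_near. Qed.

End continuity.

(** * Second moments and the tightness form *)

Section laws.
Context d1 d2 (T1 : measurableType d1) (T2 : measurableType d2) (R : realType).
Variables (P : probability T1 R) (Q : probability T2 R) (f : T1 -> T2).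

(** Stated set by set so that the two halves of [coupling], and [first_marginal], are instances of
    it as they stand. *)
Definition has_law := forall A, measurable A -> P (f @^-1` A) = Q A.

Hypotheses (mf : measurable_fun setT f) (fPQ : has_law).

Lemma ge0_integral_law (g : T2 -> \bar R) : measurable_fun setT g ->
  (forall y, 0 <= g y)%E -> (\int[Q]_y g y = \int[P]_x g (f x))%E.
Proof.
move=> mg g0; have := @ge0_integral_pushforward _ _ _ _ _ _ mf P setT g measurableT mg.
rewrite preimage_setT => <-; last by move=> y _; exact: g0.
by apply: eq_measure_integral => A mA _; rewrite /pushforward; apply/esym; exact: fPQ.
Qed.

Lemma integrable_law (g : T2 -> R) : measurable_fun setT g ->
  P.-integrable setT (fun x => (g (f x))%:E) -> Q.-integrable setT (fun y => (g y)%:E).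
Proof.
move=> mg /integrableP[_ h]; apply/integrableP; split; first exact/measurable_EFinP.
rewrite ge0_integral_law//.
by apply: measurableT_comp => //; exact/measurable_EFinP.
Qed.

Lemma law_integrable (g : T2 -> R) : measurable_fun setT g ->
  Q.-integrable setT (fun y => (g y)%:E) -> P.-integrable setT (fun x => (g (f x))%:E).
Proof.
move=> mg /integrableP[_ h]; apply/integrableP; split.
  by apply/measurable_EFinP; exact: measurableT_comp.
rewrite ge0_integral_law// in h.
by apply: measurableT_comp => //; exact/measurable_EFinP.
Qed.

Lemma integral_law (g : T2 -> R) : measurable_fun setT g ->
  Q.-integrable setT (fun y => (g y)%:E) ->
  (\int[Q]_y (g y)%:E = \int[P]_x (g (f x))%:E)%E.
Proof.
move=> mg ig.
have mg' : measurable_fun setT (fun y => (g y)%:E) by exact/measurable_EFinP.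
have hp := ge0_integral_law (measurable_funepos mg') (funepos_ge0 _).
have hn := ge0_integral_law (measurable_funeneg mg') (funeneg_ge0 _).
rewrite [LHS]integralE hp hn [RHS]integralE.
have -> : (fun x => (g (f x))%:E) = (fun y => (g y)%:E) \o f by [].
by rewrite (funepos_comp (fun y => (g y)%:E) f) (funeneg_comp (fun y => (g y)%:E) f).
Qed.

Lemma Rintegral_law (g : T2 -> R) : measurable_fun setT g ->
  Q.-integrable setT (fun y => (g y)%:E) ->
  \int[Q]_y g y = \int[P]_x g (f x).
Proof. by move=> mg ig; rewrite /Rintegral integral_law. Qed.

End laws.

Lemma image_law d1 d2 (T1 : measurableType d1) (T2 : measurableType d2) (R : realType)
    (P : probability T1 R) (f : T1 -> T2) : measurable_fun setT f ->
  exists Q : probability T2 R, has_law P Q f.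
Proof.
move=> mf; pose mf_mixin := isMeasurableFun.Build _ _ _ _ f mf.
pose F : {RV P >-> T2} := HB.pack f mf_mixin.
by exists (distribution P F).
Qed.
Section expectation.
Context d0 (T : measurableType d0) (R : realType) (P : probability T R).
Implicit Types f g : T -> R.

Definition rintegrable f := P.-integrable setT (fun x => (f x)%:E).

Lemma rintegrable_le f g : measurable_fun setT f -> rintegrable g ->
  (forall x, `|f x| <= g x) -> rintegrable f.
Proof.
move=> mf ig fg; apply: le_integrable ig => //; first exact/measurable_EFinP.
move=> x _; rewrite lee_fin; apply: (le_trans (fg x)); exact: ler_norm.
Qed.

Lemma rintegrable_meas f : rintegrable f -> measurable_fun setT f.
Proof. by case/integrableP => /measurable_EFinP. Qed.

Lemma rintegrableD f g : rintegrable f -> rintegrable g ->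
  rintegrable (fun x => f x + g x).
Proof. by move=> hf hg; exact: (integrableD _ hf hg). Qed.

Lemma rintegrableZ k f : rintegrable f -> rintegrable (fun x => k * f x).
Proof. by move=> hf; exact: (integrableZl _ _ hf). Qed.

Lemma rintegrable_cst k : rintegrable (fun=> k).
Proof. exact: finite_measure_integrable_cst. Qed.

Lemma rintegrable_sum (I : Type) (s : seq I) (f : I -> T -> R) :
  (forall i, rintegrable (f i)) -> rintegrable (fun x => \sum_(i <- s) f i x).
Proof.
move=> hf; elim: s => [|i s ih].
  by under eq_fun do rewrite big_nil; exact: rintegrable_cst.
by under eq_fun do rewrite big_cons; exact: rintegrableD.
Qed.

Lemma rexpD f g : rintegrable f -> rintegrable g ->
  \int[P]_x (f x + g x) = \int[P]_x f x + \int[P]_x g x.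
Proof. by move=> hf hg; exact: RintegralD. Qed.

Lemma rexpZ k f : rintegrable f -> \int[P]_x (k * f x) = k * \int[P]_x f x.
Proof. by move=> hf; exact: RintegralZl. Qed.

Lemma rexp_cst (k : R) : \int[P]_x k = k.
Proof. by rewrite Rintegral_cst//= probability_setT mulr1. Qed.

Lemma rexp_sum (I : Type) (s : seq I) (f : I -> T -> R) :
  (forall i, rintegrable (f i)) ->
  \int[P]_x (\sum_(i <- s) f i x) = \sum_(i <- s) \int[P]_x f i x.
Proof.
move=> hf; elim: s => [|i s ih].
  by rewrite big_nil -[RHS](rexp_cst 0); apply: eq_Rintegral => x _; rewrite big_nil.
rewrite big_cons -ih -rexpD//; last exact: rintegrable_sum.
by apply: eq_Rintegral => x _; rewrite big_cons.
Qed.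

Lemma le_rexp f g : rintegrable f -> rintegrable g -> (forall x, f x <= g x) ->
  \int[P]_x f x <= \int[P]_x g x.
Proof. by move=> hf hg fg; exact: le_Rintegral. Qed.

Lemma rexp_ge0 f : (forall x, 0 <= f x) -> 0 <= \int[P]_x f x.
Proof. by move=> f0; exact: Rintegral_ge0. Qed.

Lemma rexp_EFin f : rintegrable f -> (\int[P]_x (f x)%:E = (\int[P]_x f x)%:E)%E.
Proof. by move=> hf; rewrite /Rintegral fineK//; exact: integrable_fin_num. Qed.

Lemma norm_rexp_le f g : rintegrable f -> rintegrable g -> (forall x, `|f x| <= g x) ->
  `|\int[P]_x f x| <= \int[P]_x g x.
Proof.
move=> hf hg fg; apply: (le_trans (le_normr_Rintegral _ _)) => //.
by apply: le_rexp => //; apply: rintegrable_le hg _ => [|x]; rewrite ?normr_id//;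
  apply: measurableT_comp => //; exact: rintegrable_meas.
Qed.

Lemma quad_discr (a b c : R) : 0 <= a -> 0 <= b ->
  (forall s t : R, 0 <= s ^+ 2 * a - 2 * s * t * c + t ^+ 2 * b) -> c ^+ 2 <= a * b.
Proof.
move=> a0 b0 h; have [b_eq0|bn0] := eqVneq b 0.
  (* With [b = 0] these values turn the form into [- (a + 2) * c ^+ 2], which forces [c = 0]. *)
  have := h c (a + 1); rewrite b_eq0 => h1.
  have c0 : 0 <= c ^+ 2 by exact: sqr_ge0.
  have : 0 <= - ((a + 2) * c ^+ 2).
    by apply: (le_trans h1); rewrite le_eqVlt; apply/orP; left; apply/eqP; ring.
  by rewrite oppr_ge0 pmulr_rle0 ?mulr0//; lra.
have b_gt0 : 0 < b by rewrite lt_neqAle eq_sym bn0.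
(* Here the form equals [b * (a * b - c ^+ 2)]. *)
have h1 := h b c.
have : 0 <= b * (a * b - c ^+ 2).
  by apply: (le_trans h1); rewrite le_eqVlt; apply/orP; left; apply/eqP; ring.
by rewrite pmulr_rge0// subr_ge0.
Qed.

Lemma rexp_cauchy_schwarz f g : rintegrable (fun x => f x ^+ 2) ->
  rintegrable (fun x => g x ^+ 2) -> rintegrable (fun x => f x * g x) ->
  (\int[P]_x (f x * g x)) ^+ 2 <= (\int[P]_x (f x ^+ 2)) * \int[P]_x (g x ^+ 2).
Proof.
move=> hf hg hfg; apply: quad_discr; [by apply: rexp_ge0 => x; exact: sqr_ge0..|].
move=> s t; have : 0 <= \int[P]_x ((s * f x - t * g x) ^+ 2).
  by apply: rexp_ge0 => x; exact: sqr_ge0.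
have -> : \int[P]_x ((s * f x - t * g x) ^+ 2) =
  \int[P]_x (s ^+ 2 * f x ^+ 2 + (- 2 * s * t * (f x * g x) + t ^+ 2 * g x ^+ 2)).
  by apply: eq_Rintegral => x _; ring.
rewrite !rexpD ?rexpZ//; [|exact: rintegrableZ|exact: rintegrableZ|exact: rintegrableZ|].
  by rewrite addrA !mulNr.
by apply: rintegrableD; exact: rintegrableZ.
Qed.

End expectation.

(** * Second moment matrices of random vectors *)

Section second_moments.
Context d0 (T : measurableType d0) (R : realType) (P : probability T R) (d : nat).
Local Notation E := 'rV[R]_d.
Implicit Types X H : T -> E.

Definition sqintegrable X :=
  measurable_fun setT X /\ rintegrable P (fun w => dotp (X w) (X w)).

Definition moment2 X : R := \int[P]_w dotp (X w) (X w).

Definition crossmx X H : 'M[R]_d :=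
  \matrix_(i, j) \int[P]_w (X w ord0 i * H w ord0 j).

Lemma moment2_ge0 X : 0 <= moment2 X.
Proof. by apply: rexp_ge0 => w; exact: dotp_ge0. Qed.

Lemma coordM_le (x y : E) i j : `|x ord0 i * y ord0 j| <= dotp x x + dotp y y.
Proof.
have := coord_sqr_le x i; have := coord_sqr_le y j.
set a := x _ _; set b := y _ _; move=> hb ha; rewrite ler_norml.
have := sqr_ge0 (a - b); have := sqr_ge0 (a + b); rewrite sqrrD sqrrB.
have := sqr_ge0 a; have := sqr_ge0 b.
by move: ha hb; lra.
Qed.

Lemma rintegrable_coordM X H i j : sqintegrable X -> sqintegrable H ->
  rintegrable P (fun w => X w ord0 i * H w ord0 j).
Proof.
move=> [mX hX] [mH hH]; apply: (rintegrable_le _ (rintegrableD hX hH)) => [|w].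
  by apply: measurable_funM; exact: measurable_rV_coord.
exact: coordM_le.
Qed.

Lemma rintegrable_coord_sqr X i : sqintegrable X ->
  rintegrable P (fun w => X w ord0 i ^+ 2).
Proof. by move=> hX; exact: (rintegrable_coordM i i hX hX). Qed.

Lemma sqintegrableD X H : sqintegrable X -> sqintegrable H ->
  sqintegrable (fun w => X w + H w).
Proof.
move=> [mX hX] [mH hH]; split; first exact: measurable_rVD.
have h := rintegrableD (rintegrableZ 2 hX) (rintegrableZ 2 hH).
apply: (rintegrable_le _ h) => [|w].
  by apply: measurable_dotp; exact: measurable_rVD.
by rewrite ger0_norm ?dotp_ge0//; exact: dotpDD_le.
Qed.

Lemma rexp_coord_sqr_le X i : sqintegrable X ->
  \int[P]_w (X w ord0 i ^+ 2) <= moment2 X.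
Proof.
move=> hX; apply: le_rexp; [exact: rintegrable_coord_sqr|by case: hX|].
by move=> w; exact: coord_sqr_le.
Qed.

Lemma crossmx_sqr_le X H i j : sqintegrable X -> sqintegrable H ->
  crossmx X H i j ^+ 2 <= moment2 X * moment2 H.
Proof.
move=> hX hH; rewrite mxE.
apply: (le_trans (rexp_cauchy_schwarz _ _ _)).
- exact: rintegrable_coord_sqr.
- exact: rintegrable_coord_sqr.
- exact: rintegrable_coordM.
by apply: ler_pM; rewrite ?rexp_coord_sqr_le//; apply: rexp_ge0 => w; exact: sqr_ge0.
Qed.

Lemma crossmx_le X H i j : sqintegrable X -> sqintegrable H ->
  `|crossmx X H i j| <= Num.sqrt (moment2 X * moment2 H).
Proof.
move=> hX hH; rewrite -sqrtr_sqr ler_wsqrtr//; exact: crossmx_sqr_le.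
Qed.

Lemma crossmx_tr X H : (crossmx X H)^T = crossmx H X.
Proof. by apply/matrixP => i j; rewrite !mxE; apply: eq_Rintegral => w _; rewrite mulrC. Qed.

Lemma crossmxDl X H Y : sqintegrable X -> sqintegrable H -> sqintegrable Y ->
  crossmx (fun w => X w + H w) Y = crossmx X Y + crossmx H Y.
Proof.
move=> hX hH hY; apply/matrixP => i j; rewrite !mxE -rexpD; try exact: rintegrable_coordM.
by apply: eq_Rintegral => w _; rewrite mxE mulrDl.
Qed.

Lemma crossmxDr X H Y : sqintegrable X -> sqintegrable H -> sqintegrable Y ->
  crossmx Y (fun w => X w + H w) = crossmx Y X + crossmx Y H.
Proof.
by move=> hX hH hY; rewrite -crossmx_tr crossmxDl// linearD/= !crossmx_tr.
Qed.

Lemma covmxD X H : sqintegrable X -> sqintegrable H ->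
  crossmx (fun w => X w + H w) (fun w => X w + H w) =
  crossmx X X + (crossmx X H + (crossmx X H)^T + crossmx H H).
Proof.
move=> hX hH; rewrite crossmxDl// ?crossmxDr//; last exact: sqintegrableD.
by rewrite crossmx_tr !addrA.
Qed.

(** The expected pairing of a linear field with a displacement is the Frobenius product of its
    matrix with the cross moments; this is how the first-order term of TP is read off. *)
Lemma rexp_dotp_mulmx X H (A : 'M[R]_d) : sqintegrable X -> sqintegrable H ->
  rintegrable P (fun w => dotp (X w *m A) (H w)) /\
  \int[P]_w dotp (X w *m A) (H w) = \sum_i \sum_j A i j * crossmx X H i j.
Proof.
move=> hX hH.
have e w : dotp (X w *m A) (H w) = \sum_i \sum_j A i j * (X w ord0 i * H w ord0 j).
  rewrite exchange_big/=; apply: eq_bigr => j _; rewrite mxE mulr_suml.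
  by apply: eq_bigr => i _; rewrite mulrAC [X in X * _]mulrC -mulrA mulrCA mulrA mulrC.
have hi i j : rintegrable P (fun w => A i j * (X w ord0 i * H w ord0 j)).
  by apply: rintegrableZ; exact: rintegrable_coordM.
split; first by under eq_fun do rewrite e; do 2 apply: rintegrable_sum => ?.
under eq_Rintegral do rewrite e.
rewrite rexp_sum; last by move=> i; exact: rintegrable_sum.
apply: eq_bigr => i _; rewrite rexp_sum//; apply: eq_bigr => j _.
by rewrite rexpZ ?mxE//; exact: rintegrable_coordM.
Qed.

End second_moments.

(** * TP as a quadratic form in the second moments *)

Section tightness_form.
Variables (R : realType) (d : nat).
Hypothesis d_gt0 : (0 < d)%N.
Implicit Types S M N : 'M[R]_d.

(** For d > 0, the Frobenius inner product of the traceless parts of [S] and [M]. *)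
Definition tpform S M : R :=
  \sum_i \sum_j S i j * M i j - d%:R^-1 * \tr S * \tr M.

(* In the paper's terms [x |-> x *m tpgrad S] is the Wasserstein gradient of TP at
   a measure with second moment matrix [S]. *)
Definition tpgrad S : 'M[R]_d := 4 *: (S - (d%:R^-1 * \tr S)%:M).

Lemma tpformC S M : tpform S M = tpform M S.
Proof.
rewrite /tpform mulrAC; congr (_ - _).
by apply: eq_bigr => i _; apply: eq_bigr => j _; rewrite mulrC.
Qed.

Lemma tpformDr S M N : tpform S (M + N) = tpform S M + tpform S N.
Proof.
rewrite /tpform linearD/= mulrDr addrACA -opprD; congr (_ - _).
rewrite -big_split; apply: eq_bigr => i _; rewrite -big_split; apply: eq_bigr => j _.
by rewrite mxE mulrDr.
Qed.

Lemma tpformDl S M N : tpform (M + N) S = tpform M S + tpform N S.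
Proof. by rewrite tpformC tpformDr !(tpformC S). Qed.

Lemma tpform_tr S M : S^T = S -> tpform S M^T = tpform S M.
Proof.
move=> sS; rewrite /tpform mxtrace_tr; congr (_ - _).
rewrite exchange_big; apply: eq_bigr => i _; apply: eq_bigr => j _.
by rewrite -{1}sS !mxE.
Qed.

(** Explains the 4 in [tpgrad]: one factor 2 comes from the quadratic form, the other from the
    increment [c + c^T], whose two halves pair equally with a symmetric [S]. *)
Lemma tpgrad_sum S M : \sum_i \sum_j tpgrad S i j * M i j = 4 * tpform S M.
Proof.
pose k := d%:R^-1 * \tr S.
transitivity (\sum_i \sum_j 4 * (S i j * M i j) -
   \sum_i \sum_j (if j == i then 4 * k * M i j else 0)).
  rewrite -sumrB; apply: eq_bigr => i _; rewrite -sumrB; apply: eq_bigr => j _.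
  rewrite !mxE -/k eq_sym; case: eqP => _; rewrite ?mulr1n ?mulr0n; ring.
rewrite /tpform mulrBr; congr (_ - _).
  by rewrite mulr_sumr; apply: eq_bigr => i _; rewrite mulr_sumr.
rewrite -/k [RHS]mulrA [\tr M]/mxtrace [RHS]mulr_sumr; apply: eq_bigr => i _.
by rewrite -big_mkcond big_pred1_eq.
Qed.

Lemma tpform_le S M (u v : R) : (forall i j, `|S i j| <= u) ->
  (forall i j, `|M i j| <= v) -> `|tpform S M| <= 2 * d%:R ^+ 2 * (u * v).
Proof.
move=> hS hM; have d1 : 1 <= d%:R :> R by rewrite ler1n.
have i0 : 'I_d by exact: Ordinal d_gt0.
have u0 : 0 <= u by exact: le_trans (hS i0 i0).
have v0 : 0 <= v by exact: le_trans (hM i0 i0).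
have uv0 : 0 <= u * v by exact: mulr_ge0.
have cst_sum (c : R) : \sum_(i < d) c = d%:R * c.
  by rewrite sumr_const card_ord mulr_natl.
have tr_le N w : (forall i j, `|N i j| <= w) -> `|\tr N| <= d%:R * w.
  move=> hN; rewrite -cst_sum; apply: (le_trans (ler_norm_sum _ _ _)).
  exact: ler_sum.
(* Each of the two terms is at most d^2 u v: the first has d^2 entries, and the traces give d^-1 (d
   u)(d v) = d u v. *)
apply: (le_trans (ler_normB _ _)); rewrite -mulrA mulrDl mul1r mulrDl lerD//.
  rewrite expr2 -mulrA -!cst_sum; apply: (le_trans (ler_norm_sum _ _ _)).
  apply: ler_sum => i _; apply: (le_trans (ler_norm_sum _ _ _)).
  by apply: ler_sum => j _; rewrite normrM ler_pM.
rewrite !normrM ger0_norm ?invr_ge0//.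
rewrite ler_pdivrMl ?ltr0n//.
apply: (@le_trans _ _ ((d%:R * u) * (d%:R * v))).
  by apply: ler_pM => //; exact: tr_le.
rewrite mulrACA -expr2 expr2 -mulrA !ler_wpM2l// -[leLHS]mul1r ler_wpM2r//.
Qed.

Section expansion.
Context d0 (T : measurableType d0) (P : probability T R).
Local Notation E := 'rV[R]_d.
Variables X H : T -> E.
Hypotheses (hX : sqintegrable P X) (hH : sqintegrable P H).

Let S := crossmx P X X.
Let a := moment2 P X.
Let b := moment2 P H.

Lemma covmx_incr_le i j :
  `|(crossmx P X H + (crossmx P X H)^T + crossmx P H H) i j| <= 2 * Num.sqrt (a * b) + b.
Proof.
have h i' j' : `|crossmx P X H i' j'| <= Num.sqrt (a * b) by exact: crossmx_le.
have hb : `|crossmx P H H i j| <= b.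
  apply: (le_trans (crossmx_le _ _ hH hH)).
  by rewrite -expr2 sqrtr_sqr ger0_norm// moment2_ge0.
rewrite [X in `|X|]mxE [X in `|X + _|]mxE [X in `|_ + X + _|]mxE.
apply: (le_trans (ler_normD _ _)); rewrite lerD//.
apply: (le_trans (ler_normD _ _)); rewrite mulrDl mul1r lerD//; exact: h.
Qed.

(** Past first order there remain [2 * tpform S Q], at most 4 d^2 ab, and [tpform M M], at most 2
    d^2 (2r + b)^2 <= 2 d^2 (8 ab + 2 b^2) with r^2 = ab. These add up to the stated constants. *)
Lemma tpform_expansion :
  `|tpform (crossmx P (fun w => X w + H w) (fun w => X w + H w))
           (crossmx P (fun w => X w + H w) (fun w => X w + H w))
    - tpform S S - \int[P]_w dotp (X w *m tpgrad S) (H w)|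
  <= d%:R ^+ 2 * (20 * (a * b) + 4 * b ^+ 2).
Proof.
rewrite (rexp_dotp_mulmx (tpgrad S) hX hH).2 tpgrad_sum covmxD// -/S.
set c := crossmx P X H; set Q := crossmx P H H.
have sS : S^T = S by exact: crossmx_tr.
set M := c + c^T + Q.
have -> : tpform (S + M) (S + M) - tpform S S - 4 * tpform S c =
    2 * tpform S Q + tpform M M.
  have -> : tpform (S + M) (S + M) = tpform S S + 2 * tpform S M + tpform M M.
    move: M => M; rewrite tpformDl !tpformDr (tpformC M S); ring.
  have -> : tpform S M = 2 * tpform S c + tpform S Q.
    rewrite /M !tpformDr tpform_tr//; ring.
  ring.
have ab0 : 0 <= a * b by rewrite mulr_ge0// moment2_ge0.
have b0 : 0 <= b by exact: moment2_ge0.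
have h1 : `|tpform S Q| <= 2 * d%:R ^+ 2 * (a * b).
  apply: tpform_le => i j.
  - apply: (le_trans (crossmx_le _ _ hX hX)).
    by rewrite -expr2 sqrtr_sqr ger0_norm// moment2_ge0.
  - apply: (le_trans (crossmx_le _ _ hH hH)).
    by rewrite -expr2 sqrtr_sqr ger0_norm// moment2_ge0.
have h2 := tpform_le covmx_incr_le covmx_incr_le.
apply: (le_trans (ler_normD _ _)); rewrite normrM ger0_norm//.
have -> : d%:R ^+ 2 * (20 * (a * b) + 4 * b ^+ 2) =
   2 * (2 * d%:R ^+ 2 * (a * b)) + 2 * d%:R ^+ 2 * (8 * (a * b) + 2 * b ^+ 2) by ring.
apply: lerD; first by rewrite ler_wpM2l.
apply: (le_trans h2); rewrite ler_wpM2l ?mulr_ge0 ?sqr_ge0//.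
set r := Num.sqrt _; have r2 : r ^+ 2 = a * b by rewrite sqr_sqrtr.
rewrite -r2; have := sqr_ge0 (2 * r - b).
have -> : (2 * r - b) ^+ 2 = 4 * r ^+ 2 - 4 * (r * b) + b ^+ 2 by ring.
have -> : (2 * r + b) * (2 * r + b) = 4 * r ^+ 2 + 4 * (r * b) + b ^+ 2 by ring.
lra.
Qed.

End expansion.

Lemma TP_tpform (mu : probability 'rV[R]_d R) : sqintegrable mu id ->
  TP mu = (tpform (crossmx mu id id) (crossmx mu id id))%:E.
Proof.
move=> hmu; set S := crossmx mu id id; rewrite /TP.
have [mid hid] := hmu.
(* For fixed [x] the integrand is the form applied to two rank-one matrices, and integrating in [y]
   turns the second into [S]. The outer integral repeats the argument. *)
have inner x : (\int[mu]_y ((dotp x y) ^+ 2 - d%:R^-1 * enorm x ^+ 2 * enorm y ^+ 2)%:E)%E =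
   (tpform (\matrix_(i, j) (x ord0 i * x ord0 j)) S)%:E.
  have e y : (dotp x y) ^+ 2 - d%:R^-1 * enorm x ^+ 2 * enorm y ^+ 2 =
     \sum_i \sum_j (x ord0 i * x ord0 j) * (y ord0 i * y ord0 j)
       + (- (d%:R^-1 * dotp x x)) * dotp y y.
    rewrite !enorm_sqr mulNr; congr (_ - _).
    rewrite expr2 /dotp mulr_suml; apply: eq_bigr => i _; rewrite mulr_sumr.
    by apply: eq_bigr => j _; rewrite mulrACA.
  have hi i j : rintegrable mu (fun y => (x ord0 i * x ord0 j) * (y ord0 i * y ord0 j)).
    by apply: rintegrableZ; exact: (rintegrable_coordM _ _ hmu hmu).
  have hs : rintegrable mu (fun y =>
      \sum_i \sum_j (x ord0 i * x ord0 j) * (y ord0 i * y ord0 j)).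
    by do 2 apply: rintegrable_sum => ?.
  under eq_integral do rewrite e.
  rewrite rexp_EFin; last by apply: rintegrableD => //; exact: rintegrableZ.
  congr EFin; rewrite rexpD//; last exact: rintegrableZ.
  rewrite rexp_sum; last by move=> i; exact: rintegrable_sum.
  rewrite rexpZ// /tpform mulNr; congr (_ - _).
    apply: eq_bigr => i _; rewrite rexp_sum//; apply: eq_bigr => j _.
    by rewrite rexpZ ?mxE//; exact: (rintegrable_coordM _ _ hmu hmu).
  have -> : \tr (\matrix_(i, j) (x ord0 i * x ord0 j)) = dotp x x.
    by apply: eq_bigr => i _; rewrite mxE.
  congr (_ * _); rewrite /mxtrace /dotp rexp_sum.
    by apply: eq_bigr => i _; rewrite mxE.
  by move=> i; exact: (rintegrable_coordM _ _ hmu hmu).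
under eq_integral do rewrite inner.
have e (x : 'rV[R]_d) : tpform (\matrix_(i, j) (x ord0 i * x ord0 j)) S =
     \sum_i \sum_j S i j * (x ord0 i * x ord0 j) + (- (d%:R^-1 * \tr S)) * dotp x x.
  rewrite tpformC /tpform mulNr; congr (_ - _ * _).
    by apply: eq_bigr => i _; apply: eq_bigr => j _; congr (_ * _); rewrite mxE.
  by apply: eq_bigr => i _; rewrite mxE.
have hi i j : rintegrable mu (fun y => S i j * (y ord0 i * y ord0 j)).
  by apply: rintegrableZ; exact: (rintegrable_coordM _ _ hmu hmu).
have hs : rintegrable mu (fun y => \sum_i \sum_j S i j * (y ord0 i * y ord0 j)).
  by do 2 apply: rintegrable_sum => ?.
under eq_integral do rewrite e.
rewrite rexp_EFin; last by apply: rintegrableD => //; exact: rintegrableZ.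
congr EFin; rewrite rexpD//; last exact: rintegrableZ.
rewrite rexp_sum; last by move=> i; exact: rintegrable_sum.
rewrite rexpZ// /tpform mulNr; congr (_ - _).
  apply: eq_bigr => i _; rewrite rexp_sum//; apply: eq_bigr => j _.
  by rewrite rexpZ ?mxE//; exact: (rintegrable_coordM _ _ hmu hmu).
congr (_ * _); rewrite /mxtrace /dotp rexp_sum.
  by apply: eq_bigr => i _; rewrite mxE.
by move=> i; exact: (rintegrable_coordM _ _ hmu hmu).
Qed.


End tightness_form.
(** * Transport estimates for the potential *)

Section moments.
Variables (R : realType) (d : nat) (p : R).
Hypothesis p2 : 2 <= p.
Local Notation E := 'rV[R]_d.

Let p0 : 0 < p. Proof. by move: p2; lra. Qed.

(** Where [2 <= p] enters the moment bounds: for [t > e] the ratio [t / e] exceeds 1, so its square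
    is below its p-th power. This pointwise bound takes the place of Jensen's inequality. *)
Lemma sqr_le_powR (t e : R) : 0 <= t -> 0 < e ->
  t ^+ 2 <= e ^+ 2 + e ^+ 2 / e `^ p * t `^ p.
Proof.
move=> t0 e0; have ep : 0 < e `^ p by rewrite powR_gt0.
have r0 : 0 <= e ^+ 2 / e `^ p * t `^ p.
  by apply: mulr_ge0; [apply: divr_ge0; [exact: sqr_ge0|exact: powR_ge0]|exact: powR_ge0].
have [te|/ltW et] := leP t e.
  by rewrite (le_trans (y := e ^+ 2)) ?lerDl// ler_pXn2r// nnegrE// ltW.
apply: (@le_trans _ _ (e ^+ 2 / e `^ p * t `^ p)); last by rewrite lerDr sqr_ge0.
have te : t = e * (t / e) by rewrite mulrCA divff ?mulr1// gt_eqF.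
have q0 : 0 <= t / e by rewrite divr_ge0// ltW.
rewrite {2}te (powRM _ (ltW e0) q0) mulrA mulfVK ?gt_eqF//.
rewrite {1}te exprMn ler_wpM2l ?sqr_ge0// -powR_mulrn// ler_powR//.
by rewrite ler_pdivlMr// mul1r.
Qed.

Section random_vector.
Context d0 (T : measurableType d0) (P : probability T R).
Implicit Types X Y : T -> E.

Definition pintegrable X := measurable_fun setT X /\
  (\int[P]_w (enorm (X w) `^ p)%:E < +oo)%E.

Lemma pintegrable_rintegrable X : pintegrable X ->
  rintegrable P (fun w => enorm (X w) `^ p).
Proof.
move=> [mX hX]; apply/integrableP; split.
  by apply/measurable_EFinP; exact: measurable_enorm_powR.
by under eq_integral do rewrite gee0_abs ?lee_fin ?powR_ge0//.
Qed.

Lemma sqr_le_rintegrable X (e : R) : pintegrable X ->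
  rintegrable P (fun w => e ^+ 2 + e ^+ 2 / e `^ p * enorm (X w) `^ p).
Proof.
move=> hX; apply: rintegrableD; first exact: rintegrable_cst.
by apply: rintegrableZ; exact: pintegrable_rintegrable.
Qed.

Lemma pintegrable_sqintegrable X : pintegrable X -> sqintegrable P X.
Proof.
move=> hX; have [mX _] := hX; split => //.
apply: (rintegrable_le _ (sqr_le_rintegrable 1 hX)) => [|w]; first exact: measurable_dotp.
rewrite ger0_norm ?dotp_ge0// -enorm_sqr; apply: sqr_le_powR => //; exact: enorm_ge0.
Qed.

Lemma moment2_le X (e : R) : pintegrable X -> 0 < e ->
  (\int[P]_w (enorm (X w) `^ p)%:E <= (e `^ p)%:E)%E -> moment2 P X <= 2 * e ^+ 2.
Proof.
move=> hX e0; have hp := pintegrable_rintegrable hX.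
rewrite rexp_EFin// lee_fin => hle.
have ep : 0 < e `^ p by rewrite powR_gt0.
(* Both terms of the majorant integrate to at most [e ^+ 2], whence the factor 2. *)
apply: (@le_trans _ _ (\int[P]_w (e ^+ 2 + e ^+ 2 / e `^ p * enorm (X w) `^ p))).
  apply: le_rexp; [by case: (pintegrable_sqintegrable hX)|exact: sqr_le_rintegrable|].
  by move=> w; rewrite -enorm_sqr; apply: sqr_le_powR => //; exact: enorm_ge0.
rewrite rexpD; [|exact: rintegrable_cst|exact: rintegrableZ].
rewrite rexp_cst rexpZ// mulrDl mul1r lerD2l.
by rewrite -mulrA ler_piMr ?sqr_ge0// ler_pdivrMl// mulr1.
Qed.

Lemma pintegrableD X Y : pintegrable X -> pintegrable Y ->
  pintegrable (fun w => X w + Y w).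
Proof.
move=> hX hY; have [mX _] := hX; have [mY _] := hY.
have mXY : measurable_fun setT (fun w => X w + Y w) by exact: measurable_rVD.
split => //; have h := rintegrableZ (2 `^ p)
  (rintegrableD (pintegrable_rintegrable hX) (pintegrable_rintegrable hY)).
have hi : rintegrable P (fun w => enorm (X w + Y w) `^ p).
  apply: (rintegrable_le _ h) => [|w]; first exact: measurable_enorm_powR.
  by rewrite ger0_norm ?powR_ge0//; apply: enormD_powR_le; exact: ltW.
by rewrite rexp_EFin// ltry.
Qed.

Lemma pintegrableN X : pintegrable X -> pintegrable (fun w => - X w).
Proof.
move=> [mX hX]; split; first exact: measurable_rVN.
by under eq_integral do rewrite enormN.
Qed.

Lemma pintegrable_law X (mu : probability E R) : measurable_fun setT X ->
  has_law P mu X -> Pp p mu -> pintegrable X.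
Proof.
move=> mX lX hmu; split => //.
have mg : measurable_fun setT (fun x : E => (enorm x `^ p)%:E).
  by apply/measurable_EFinP; apply: measurable_enorm_powR; exact: measurable_id.
by rewrite -(ge0_integral_law mX lX mg)// => x; rewrite lee_fin powR_ge0.
Qed.

Lemma Pp_pintegrable X (mu : probability E R) :
  has_law P mu X -> pintegrable X -> Pp p mu.
Proof.
move=> lX [mX hX].
have mg : measurable_fun setT (fun x : E => (enorm x `^ p)%:E).
  by apply/measurable_EFinP; apply: measurable_enorm_powR; exact: measurable_id.
by rewrite /Pp (ge0_integral_law mX lX mg)// => x; rewrite lee_fin powR_ge0.
Qed.

Lemma crossmx_law X (mu : probability E R) : measurable_fun setT X ->
  has_law P mu X -> sqintegrable mu id -> crossmx P X X = crossmx mu id id.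
Proof.
move=> mX lX hmu; apply/matrixP => i j; rewrite !mxE.
apply/esym; apply: (Rintegral_law mX lX (g := fun x => x ord0 i * x ord0 j)).
  by apply: measurable_funM; exact: measurable_coord.
exact: (rintegrable_coordM i j hmu hmu).
Qed.

Lemma moment2_law X (mu : probability E R) : measurable_fun setT X ->
  has_law P mu X -> sqintegrable mu id -> moment2 P X = moment2 mu id.
Proof.
move=> mX lX [_ hmu].
apply/esym; apply: (Rintegral_law mX lX (g := fun x => dotp x x)) => //.
by apply: measurable_dotp; exact: measurable_id.
Qed.

End random_vector.

Lemma Pp_sqintegrable (mu : probability E R) : Pp p mu -> sqintegrable mu id.
Proof.
move=> hmu; apply: pintegrable_sqintegrable; split => //; exact: measurable_id.
Qed.

(** Finite moments make the optimal cost finite, so the [fine] inside [Wp] discards nothing and the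
    p-th power of [Wp] is the cost itself. *)
Lemma Wp_optimal (mu nu : probability E R) : Pp p mu -> Pp p nu ->
  exists pi, [/\ coupling mu nu pi,
    forall pi', coupling mu nu pi' -> (cost p pi <= cost p pi')%E &
    cost p pi = (Wp p mu nu `^ p)%:E].
Proof.
move=> hmu hnu; have [pi [cpi opt]] := optimal_coupling_exists mu nu p0.
exists pi; split => //.
have -> : Wp p mu nu = fine (cost p pi) `^ p^-1.
  rewrite /Wp; congr (fine _ `^ _); apply/eqP; rewrite eq_le; apply/andP; split.
    by apply: ereal_inf_lbound; exists pi.
  by apply: le_ereal_inf_tmp => _ [pi' cpi' <-]; exact: opt.
have h1 : pintegrable pi fst by exact: pintegrable_law measurable_fst cpi.1 hmu.
have h2 : pintegrable pi snd by exact: pintegrable_law measurable_snd cpi.2 hnu.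
have [_ h] := pintegrableD h1 (pintegrableN h2).
have c0 : (0 <= cost p pi)%E by apply: integral_ge0 => z _; rewrite lee_fin powR_ge0.
rewrite -powRrM mulVf ?gt_eqF// powRr1 ?fine_ge0// fineK// ge0_fin_numE//.
Qed.

Section transport.
Hypothesis d_gt0 : (0 < d)%N.
Context d0 (T : measurableType d0) (P : probability T R).
Variables (X Y : T -> E) (mu nu : probability E R) (e : R).
Hypotheses (mX : measurable_fun setT X) (mY : measurable_fun setT Y).
Hypotheses (lX : has_law P mu X) (lY : has_law P nu Y).
Hypotheses (hmu : Pp p mu) (hnu : Pp p nu) (e0 : 0 < e).
Hypothesis XYe : (\int[P]_w (enorm (X w - Y w) `^ p)%:E <= (e `^ p)%:E)%E.

Let H w := Y w - X w.

Lemma displacement_pintegrable : pintegrable P H.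
Proof.
apply: pintegrableD; first exact: pintegrable_law lY hnu.
by apply: pintegrableN; exact: pintegrable_law lX hmu.
Qed.

Lemma displacement_moment2 : moment2 P H <= 2 * e ^+ 2.
Proof.
apply: (moment2_le displacement_pintegrable e0).
have -> : (fun w => (enorm (H w) `^ p)%:E) = (fun w => (enorm (X w - Y w) `^ p)%:E).
  by apply/funext => w; rewrite /H (enorm_distC (Y w)).
exact: XYe.
Qed.

Let hX : sqintegrable P X.
Proof. by apply: pintegrable_sqintegrable; exact: pintegrable_law lX hmu. Qed.

Let hH : sqintegrable P H.
Proof. by apply: pintegrable_sqintegrable; exact: displacement_pintegrable. Qed.

Definition covmx (m : probability E R) : 'M[R]_d := crossmx m id id.
Definition TPr (m : probability E R) : R := tpform (covmx m) (covmx m).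

Let covnu : crossmx P (fun w => X w + H w) (fun w => X w + H w) = covmx nu.
Proof.
rewrite /covmx -(crossmx_law mY lY); last exact: Pp_sqintegrable.
by congr crossmx; apply/funext => w; rewrite /H addrCA subrr addr0.
Qed.

Let covmu : crossmx P X X = covmx mu.
Proof. by apply: crossmx_law => //; exact: Pp_sqintegrable. Qed.

(** The general expansion with the displacement's second moment bounded by 2 e^2: 20 becomes 40, and
    4 (2 e^2)^2 = 16 e^4. Only an upper bound [e] of the transport distance is involved, not
    optimality. *)
Lemma TP_expansion :
  rintegrable P (fun w => dotp (X w *m tpgrad (covmx mu)) (Y w - X w)) /\
  `|TPr nu - TPr mu - \int[P]_w dotp (X w *m tpgrad (covmx mu)) (Y w - X w)|
    <= d%:R ^+ 2 * (40 * moment2 mu id * e ^+ 2 + 16 * e ^+ 4).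
Proof.
split; first exact: (rexp_dotp_mulmx _ hX hH).1.
have := tpform_expansion d_gt0 hX hH; rewrite covnu covmu => h.
apply: (le_trans h); rewrite ler_wpM2l ?sqr_ge0//.
have hb := displacement_moment2; have b0 : 0 <= moment2 P H by exact: moment2_ge0.
rewrite (moment2_law mX lX (Pp_sqintegrable hmu)).
have a0 : 0 <= moment2 mu id by exact: moment2_ge0.
apply: lerD.
  have -> : 40 * moment2 mu id * e ^+ 2 = 20 * (moment2 mu id * (2 * e ^+ 2)) by ring.
  by rewrite ler_wpM2l// ler_wpM2l.
have -> : 16 * e ^+ 4 = 4 * (2 * e ^+ 2) ^+ 2 by ring.
by rewrite ler_wpM2l// ler_pXn2r// nnegrE// mulr_ge0// sqr_ge0.
Qed.

Lemma covmx_transport (i j : 'I_d) : e <= 1 ->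
  `|covmx nu i j - covmx mu i j| <= (2 * Num.sqrt (2 * moment2 mu id) + 2) * e.
Proof.
move=> e1; have := covmx_incr_le hX hH i j.
have hb := displacement_moment2; have b0 : 0 <= moment2 P H by exact: moment2_ge0.
have a0 : 0 <= moment2 mu id by exact: moment2_ge0.
rewrite (moment2_law mX lX (Pp_sqintegrable hmu)) => h.
have -> : covmx nu i j - covmx mu i j =
    (crossmx P X H + (crossmx P X H)^T + crossmx P H H) i j.
  have <- : covmx nu - covmx mu = crossmx P X H + (crossmx P X H)^T + crossmx P H H.
    by rewrite -covnu -covmu covmxD// addrC addKr.
  by rewrite [RHS]mxE [X in _ = _ + X]mxE.
apply: (le_trans h); rewrite [leRHS]mulrDl; apply: lerD.
  rewrite -mulrA ler_wpM2l//.
  have -> : Num.sqrt (2 * moment2 mu id) * e = Num.sqrt (moment2 mu id * (2 * e ^+ 2)).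
    rewrite -[in LHS](ger0_norm (ltW e0)) -sqrtr_sqr -sqrtrM ?mulr_ge0//.
    by congr Num.sqrt; ring.
  by rewrite ler_wsqrtr// ler_wpM2l.
apply: (le_trans hb); rewrite ler_wpM2l// expr2 ger_pMr//.
Qed.

End transport.
End moments.
(** * Strong subdifferentials are carried by the graph of the gradient *)

Section strong_subdifferential.
Variables (R : realType) (d : nat) (p : R).
Hypotheses (p2 : 2 <= p) (d_gt0 : (0 < d)%N).
Local Notation E := 'rV[R]_d.

Let p0 : 0 < p. Proof. by move: p2; lra. Qed.

(** Bounded, increasing on nonnegative reals, and zero there only at 0: it makes a squared residual
    testable under narrow convergence without hiding its zeros. *)
Definition sat (s : R) : R := s / (1 + s).

Lemma sat_ge0 s : 0 <= s -> 0 <= sat s.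
Proof. by move=> s0; rewrite divr_ge0// addr_ge0. Qed.

Lemma sat_le s t : 0 <= s -> s <= t -> sat s <= sat t.
Proof.
move=> s0 st; have t0 := le_trans s0 st.
rewrite ler_pdivrMr ?ltr_wpDr// mulrAC ler_pdivlMr ?ltr_wpDr//.
by rewrite !mulrDr !mulr1 [leRHS]addrC -[leLHS]addrC (mulrC t) lerD2l.
Qed.

Lemma sat_le1 s : 0 <= s -> sat s <= 1.
Proof. by move=> s0; rewrite ler_pdivrMr ?ltr_wpDr// mul1r lerDr. Qed.

(** Shaped for the bound |x + y|^2 <= 2 |x|^2 + 2 |y|^2: the main part stays saturated, while the
    error may leave linearly. *)
Lemma satD_le s t : 0 <= s -> 0 <= t -> sat (2 * s + t) <= 2 * sat s + t.
Proof.
move=> s0 t0; have h : 0 < 1 + (2 * s + t) by rewrite ltr_wpDr// addr_ge0// mulr_ge0.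
rewrite /sat mulrDl; apply: lerD.
  rewrite mulrA ler_pdivrMr// mulrAC ler_pdivlMr ?ltr_wpDr//.
  by rewrite ler_wpM2l ?mulr_ge0// lerD2l; lra.
by rewrite ler_pdivrMr// ler_peMr// lerDl addr_ge0// mulr_ge0.
Qed.

Definition defect (A : 'M[R]_d) (z : E * E) : R :=
  sat (dotp (z.2 - z.1 *m A) (z.2 - z.1 *m A)).

Lemma defect_ge0 A z : 0 <= defect A z.
Proof. by apply: sat_ge0; exact: dotp_ge0. Qed.

Lemma defect_le1 A z : defect A z <= 1.
Proof. by apply: sat_le1; exact: dotp_ge0. Qed.

Lemma measurable_residual (A : 'M[R]_d) :
  measurable_fun setT (fun z : E * E => z.2 - z.1 *m A).
Proof.
apply: measurable_rVB; first exact: measurable_snd.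
exact: measurable_mulmx measurable_fst.
Qed.

Lemma measurable_sat_inv (A : 'M[R]_d) : measurable_fun setT
  (fun z : E * E => (1 + dotp (z.2 - z.1 *m A) (z.2 - z.1 *m A))^-1).
Proof.
under eq_fun do rewrite -powR_inv1 ?addr_ge0 ?dotp_ge0//.
apply: (measurableT_comp (measurable_powR (-1))).
apply: measurable_funD; first exact: measurable_cst.
by apply: measurable_dotp; exact: measurable_residual.
Qed.

Lemma measurable_defect A : measurable_fun setT (defect A).
Proof.
apply: measurable_funM; last exact: measurable_sat_inv.
by apply: measurable_dotp; exact: measurable_residual.
Qed.

Lemma rintegrable_defect (g : probability (E * E)%type R) A : rintegrable g (defect A).
Proof.
apply: (rintegrable_le _ (rintegrable_cst g 1)) => [|z]; first exact: measurable_defect.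
by rewrite ger0_norm ?defect_ge0// defect_le1.
Qed.

Lemma normr_dotp_le_enorm (x y : E) : `|dotp x y| <= enorm x * enorm y.
Proof.
rewrite ler_norml dotp_le_enorm andbT lerNl -dotpNl.
by rewrite -(enormN x) dotp_le_enorm.
Qed.

(** The lower bound makes [x2] integrable under a plan; the upper one lets second moments control
    the q-th moment of a linear image. *)
Lemma conj_exp_bounds : 1 <= conj_exp p <= 2.
Proof.
rewrite /conj_exp; have h : 0 < p - 1 by move: p2; lra.
by apply/andP; split; rewrite ?ler_pdivlMr ?ler_pdivrMr//; move: p2; lra.
Qed.

Lemma rintegrable_conj (g : probability (E * E)%type R) :
  (mom2 (conj_exp p) g < +oo)%E -> rintegrable g (fun z => enorm z.2).
Proof.
move=> h; have hq : rintegrable g (fun z : E * E => enorm z.2 `^ conj_exp p).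
  apply/integrableP; split.
    by apply/measurable_EFinP; apply: measurable_enorm_powR; exact: measurable_snd.
  by under eq_integral do rewrite gee0_abs ?lee_fin ?powR_ge0//.
apply: (rintegrable_le _ (rintegrableD (rintegrable_cst g 1) hq)) => [|z].
  by apply: measurable_enorm; exact: measurable_snd.
rewrite ger0_norm ?enorm_ge0//; have [le1|/ltW ge1] := leP (enorm z.2) 1.
  by rewrite (le_trans le1)// lerDl powR_ge0.
apply: (@le_trans _ _ (enorm z.2 `^ conj_exp p)); last by rewrite lerDr.
by apply: le1r_powR => //; case/andP: conj_exp_bounds.
Qed.

Section perturbation.
Variables (A : 'M[R]_d) (t : R).
Hypothesis t0 : 0 < t.

(* Testing the subdifferential inequality against the bounded displacement
   [t w / (1 + |w|^2)], where [w = x2 - x1 A], produces exactly [t * defect]. *)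
Definition saturated (z : E * E) : E :=
  (1 + dotp (z.2 - z.1 *m A) (z.2 - z.1 *m A))^-1 *: (z.2 - z.1 *m A).

Lemma saturated_enorm z : enorm (saturated z) <= 1.
Proof.
rewrite -(@ler_pXn2r _ 2) ?nnegrE ?enorm_ge0// expr1n enorm_sqr /saturated.
rewrite dotpZl dotpZr; set s := dotp _ _; have s0 : 0 <= s by exact: dotp_ge0.
have h : 0 < 1 + s by rewrite ltr_wpDr.
rewrite ler_pdivrMl// mulr1 ler_pdivrMl//.
have := mulr_ge0 s0 s0; lra.
Qed.

Definition perturbed (z : E * E) : E := z.1 + t *: saturated z.

Lemma measurable_perturbed : measurable_fun setT perturbed.
Proof.
apply: measurable_rVD; first exact: measurable_fst.
apply: measurable_rVZ; first exact: measurable_cst.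
apply: measurable_rVZ; first exact: measurable_sat_inv.
exact: measurable_residual.
Qed.

Lemma perturbed_displacement z : enorm (z.1 - perturbed z) <= t.
Proof.
rewrite /perturbed opprD addrA subrr add0r enormN enormZ gtr0_norm//.
by rewrite ger_pMr// saturated_enorm.
Qed.

Lemma perturbed_cost (g : probability (E * E)%type R) :
  (\int[g]_z (enorm (z.1 - perturbed z) `^ p)%:E <= (t `^ p)%:E)%E.
Proof.
apply: (@le_trans _ _ (\int[g]_z (cst (t `^ p)%:E z))%E).
  apply: ge0_le_integral => //.
  - by move=> z _; rewrite lee_fin powR_ge0.
  - apply/measurable_EFinP; apply: measurable_enorm_powR; apply: measurable_rVB.
      exact: measurable_fst.
    exact: measurable_perturbed.
  - move=> z _; rewrite lee_fin; apply: ge0_ler_powR; rewrite ?nnegrE ?enorm_ge0//.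
    + exact: ltW.
    + exact: ltW.
    + exact: perturbed_displacement.
by rewrite integral_cst//= probability_setT mule1.
Qed.

Lemma perturbed_gain z : dotp z.2 (perturbed z - z.1) -
  dotp (z.1 *m A) (perturbed z - z.1) = t * defect A z.
Proof.
rewrite -dotpNl -dotpDl /perturbed addrAC subrr add0r dotpZr /saturated dotpZr.
by rewrite /defect /sat [X in t * X]mulrC.
Qed.

End perturbation.

(** Along the perturbation, the subdifferential inequality and the expansion of TP bound t times the
    mean defect by K t^2 + eps t. Dividing by t leaves an arbitrarily small bound. *)
Theorem strong_subdiff_graph (mu : probability E R) (g : probability (E * E)%type R) :
  strong_frechet_subdiff p (@TP R d) mu g ->
  \int[g]_z defect (tpgrad (covmx mu)) z = 0.
Proof.
move=> [hmu [_ [[_ m2] [fm h]]]].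
set A := tpgrad (covmx mu); pose a := moment2 mu id.
have a0 : 0 <= a by exact: moment2_ge0.
pose K := d%:R ^+ 2 * (40 * a + 16).
have K0 : 0 <= K.
  by apply: mulr_ge0; [exact: sqr_ge0|rewrite addr_ge0// mulr_ge0].
apply/eqP; rewrite eq_le rexp_ge0; last by move=> z; exact: defect_ge0.
rewrite andbT; apply/ler_addgt0Pr => eta eta0; rewrite add0r.
pose eps := eta / 2; have eps0 : 0 < eps by rewrite divr_gt0.
have [delta [delta0 {}h]] := h eps eps0.
(* The three bounds give, in order, admissibility for [delta], [t ^+ 4 <= t ^+ 2], and
   [K * t <= eps]; [K + 1] avoids dividing by zero. *)
pose t := Num.min (Num.min (delta / 2) 1) (eps / (K + 1)).
have K1 : 0 < K + 1 by rewrite ltr_wpDl.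
have t0 : 0 < t by rewrite /t !lt_min ltr01 !divr_gt0.
have td : t < delta.
  by rewrite (@le_lt_trans _ _ (delta / 2)) ?ge_min ?lexx// ltr_pdivrMr// ltr_pMr// ltr1n.
have t1 : t <= 1 by rewrite !ge_min lexx orbT.
have Kt : K * t <= eps.
  apply: (@le_trans _ _ (K * (eps / (K + 1)))).
    by rewrite ler_wpM2l// ge_min lexx orbT.
  by rewrite mulrCA ger_pMr// ler_pdivrMr// mul1r lerDl.
pose Y := perturbed A t; have mY : measurable_fun setT Y by exact: measurable_perturbed.
have [nu lY] := image_law g mY.
have mf : measurable_fun setT (fun z : E * E => (z, Y z)).
  exact: measurable_fun_pair.
(* The displacement depends on [x2] as well as [x1], and this plan need not be optimal. The strong
   inequality, quantified over all of [Gamma], allows such a competitor. *)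
have [b lb] := image_law g mf.
have cY := perturbed_cost A t0 g.
have hfst : pintegrable p g fst.
  exact: pintegrable_law measurable_fst fm hmu.
have hYd : pintegrable p g (fun z => - (z.1 - Y z)).
  apply: pintegrableN; split.
    by apply: measurable_rVB => //; exact: measurable_fst.
  by apply: le_lt_trans cY _; rewrite ltry.
have hnu : Pp p nu.
  apply: (Pp_pintegrable lY).
  have := pintegrableD p2 hfst hYd.
  have -> // : (fun w : E * E => w.1 + - (w.1 - Y w)) = Y.
  by apply/funext => z; rewrite opprB addrCA subrr addr0.
have Gb : Gamma g nu b.
  split=> [C mC|C mC].
    by rewrite -lb// -[fst @^-1` C]setTI; exact: measurable_fst.
  rewrite -lb -?lY//; rewrite -[snd @^-1` C]setTI; exact: measurable_snd.
have mc : measurable_fun setT (fun x : (E * E) * E => enorm (x.1.1 - x.2) `^ p).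
  apply: measurable_enorm_powR; apply: measurable_rVB; last exact: measurable_snd.
  exact: (measurableT_comp measurable_fst measurable_fst).
have cb : (cost13 p b <= (t `^ p)%:E)%E.
  rewrite /cost13 (ge0_integral_law mf lb)//; first exact/measurable_EFinP.
  by move=> y; rewrite lee_fin powR_ge0.
have cb0 : (0 <= cost13 p b)%E by apply: integral_ge0 => x _; rewrite lee_fin powR_ge0.
have Ct : Cpb p b <= t.
  apply: (@le_trans _ _ ((t `^ p) `^ p^-1)).
    apply: ge0_ler_powR.
    - by rewrite invr_ge0 ltW.
    - by rewrite nnegrE fine_ge0.
    - by rewrite nnegrE powR_ge0.
    - by rewrite -lee_fin fineK// ge0_fin_numE// (le_lt_trans cb)// ltry.
  by rewrite -powRrM mulfV ?gt_eqF// powRr1// ltW.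
have := h nu hnu b Gb (le_lt_trans Ct td).
have mF : measurable_fun setT (fun x : (E * E) * E => dotp x.1.2 (x.2 - x.1.1)).
  apply: measurable_dotp.
    exact: (measurableT_comp measurable_snd measurable_fst).
  apply: measurable_rVB; first exact: measurable_snd.
  exact: (measurableT_comp measurable_fst measurable_fst).
have iF : rintegrable g (fun z => dotp z.2 (Y z - z.1)).
  apply: (rintegrable_le _ (rintegrableZ t (rintegrable_conj m2))) => [|z].
    apply: measurable_dotp; first exact: measurable_snd.
    by apply: measurable_rVB => //; exact: measurable_fst.
  apply: (le_trans (normr_dotp_le_enorm _ _)); rewrite mulrC ler_wpM2r ?enorm_ge0//.
  by rewrite enorm_distC; exact: perturbed_displacement.
have -> : pairing b = (\int[g]_z dotp z.2 (Y z - z.1))%:E.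
  rewrite /pairing -rexp_EFin// (integral_law mf lb mF)//.
  exact: (integrable_law mf lb mF iF).
rewrite (TP_tpform (Pp_sqintegrable p2 hmu)) (TP_tpform (Pp_sqintegrable p2 hnu)).
have [iG TPG] := TP_expansion p2 d_gt0 measurable_fst mY fm lY hmu hnu t0 cY.
rewrite -EFinB -EFinB lee_fin => hle.
have gain : t * \int[g]_z defect A z =
    \int[g]_z dotp z.2 (Y z - z.1) - \int[g]_z dotp (z.1 *m A) (Y z - z.1).
  rewrite -rexpZ; last exact: rintegrable_defect.
  rewrite -RintegralB//; apply: eq_Rintegral => z _.
  by rewrite -perturbed_gain.
have t4 : t ^+ 4 <= t ^+ 2 by rewrite ler_wiXn2l// ltW.
have rem : d%:R ^+ 2 * (40 * moment2 mu id * t ^+ 2 + 16 * t ^+ 4) <= t * (K * t).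
  rewrite /K -/a [leRHS](_ : _ = d%:R ^+ 2 * (40 * a * t ^+ 2 + 16 * t ^+ 2)); last by ring.
  by rewrite ler_wpM2l ?sqr_ge0// lerD2l ler_wpM2l.
have Kt' : t * (K * t) <= t * eps by rewrite ler_wpM2l// ltW.
have epsC : eps * Cpb p b <= t * eps by rewrite mulrC ler_wpM2r// ltW.
have : t * \int[g]_z defect A z <= t * eta.
  have -> : t * eta = t * eps + t * eps by rewrite -mulrDr -splitr.
  move: TPG; rewrite ler_norml => /andP[_ TPG].
  move: hle gain TPG rem; rewrite -/(TPr mu) -/(TPr nu).
  set I1 := \int[g]_z dotp z.2 _; set I2 := \int[g]_z dotp (_ *m _) _.
  set I3 := t * _; set r1 := d%:R ^+ 2 * _.
  by move: Kt' epsC; lra.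
by rewrite ler_pM2l.
Qed.

End strong_subdifferential.
(** * Stability under narrow convergence *)

Section lipschitz_tests.
Variables (R : realType) (d : nat).
Local Notation E := 'rV[R]_d.

(** Functions tame enough for both topologies at once: bounded and continuous for narrow
    convergence, Lipschitz for transport estimates. *)
Definition lipschitz_test (k : R) (f : E -> R) :=
  [/\ 0 <= k, forall x, 0 <= f x <= 1 & forall x y, f x <= f y + k * enorm (x - y)].

Lemma lipschitz_test_dist k f x y : lipschitz_test k f ->
  `|f x - f y| <= k * enorm (x - y).
Proof.
move=> [_ _ h]; rewrite ler_norml lerNl opprB lerBlDl lerBlDl.
by rewrite h andbT enorm_distC h.
Qed.

Lemma lipschitz_test_continuous k f : lipschitz_test k f -> continuous f.
Proof.
move=> hf x; have FFx : Filter (nbhs x) by exact: nbhs_filter.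
apply/cvgrPdist_lt => e e0.
have cx : continuous (fun y : E => x - y).
  move=> y; have FFy : Filter (nbhs y) by exact: nbhs_filter.
  by apply: cvgB; [exact: cvg_cst|exact: cvg_id].
have ck : (fun y : E => k * enorm (x - y)) @ x --> k * enorm (x - x).
  by apply: cvgM; [exact: cvg_cst|exact: (@continuous_enorm R d E _ cx x)].
rewrite subrr enorm0 mulr0 in ck.
have ck' : \forall y \near x, k * enorm (x - y) < e by apply: cvgr_lt ck _ _.
apply: filterS ck' => y; apply: le_lt_trans.
exact: lipschitz_test_dist hf.
Qed.

Lemma lipschitz_test_measurable k f : lipschitz_test k f -> measurable_fun setT f.
Proof. by move=> hf; apply: continuous_measurable_rV; exact: lipschitz_test_continuous hf. Qed.

Lemma lipschitz_test_rintegrable k f (mu : probability E R) :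
  lipschitz_test k f -> rintegrable mu f.
Proof.
move=> hf; apply: (rintegrable_le _ (rintegrable_cst mu 1)) => [|x].
  exact: lipschitz_test_measurable hf.
by case: hf => _ /(_ x) /andP[f0 f1] _; rewrite ger0_norm.
Qed.

Section open_approximation.
Variables (U : set E) (k : R).
Hypotheses (k0 : 0 <= k) (U_proper : ~` U !=set0).

Definition cutoff_set x : set R :=
  [set Num.min 1 (k * enorm (x - y)) | y in ~` U].
(** The function min(1, k dist(x, ~U)), with the truncation placed inside the infimum. *)
Definition cutoff x : R := inf (cutoff_set x).

Let kd0 (x y : E) : 0 <= k * enorm (x - y).
Proof. by rewrite mulr_ge0// enorm_ge0. Qed.

Let has_lb x : has_lbound (cutoff_set x).
Proof. by exists 0 => _ [y _ <-]; rewrite le_min ler01 kd0. Qed.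

Let nonempty x : cutoff_set x !=set0.
Proof. by case: U_proper => y nUy; exists (Num.min 1 (k * enorm (x - y))), y. Qed.

Lemma cutoff_le x y : ~ U y -> cutoff x <= Num.min 1 (k * enorm (x - y)).
Proof. by move=> nUy; apply: ge_inf => //; exists y. Qed.

Lemma cutoff_lipschitz : lipschitz_test k cutoff.
Proof.
split => // [x|x y].
  apply/andP; split.
    by apply: lb_le_inf => // _ [y _ <-]; rewrite le_min ler01 kd0.
  by case: U_proper => y nUy; apply: (le_trans (cutoff_le x nUy)); rewrite ge_min lexx.
rewrite -lerBlDr; apply: lb_le_inf => // _ [u nUu <-].
rewrite lerBlDr; apply: (le_trans (cutoff_le x nUu)).
have tri : k * enorm (x - u) <= k * enorm (y - u) + k * enorm (x - y).
  rewrite -mulrDr ler_wpM2l// [leRHS]addrC (le_trans _ (ler_enormD _ _))//.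
  by rewrite addrA subrK.
have := kd0 x y; have := tri.
by case: (leP 1 (k * enorm (y - u))); case: (leP 1 (k * enorm (x - u))); lra.
Qed.

Lemma cutoff_out x : ~ U x -> cutoff x = 0.
Proof.
move=> nUx; case: cutoff_lipschitz => _ /(_ x) /andP[f0 _] _.
apply/eqP; rewrite eq_le f0 andbT; apply: (le_trans (cutoff_le x nUx)).
by rewrite subrr enorm0 mulr0 ge_min lexx orbT.
Qed.

Lemma cutoff_in n x : n.+1%:R <= k -> erosion U n x -> 1 <= cutoff x.
Proof.
move=> nk ex; apply: lb_le_inf => // _ [y nUy <-]; rewrite le_min lexx/=.
(* Erosion uses sup-norm balls and the cutoff the Euclidean norm; the latter dominates, so the
   separation persists. *)
have h : n.+1%:R^-1 <= enorm (x - y).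
  rewrite leNgt; apply/negP => lt; apply: ex; exists y => //.
  split; first by rewrite invr_gt0.
  move=> i j; rewrite (ord1 i) /ball/=; apply: le_lt_trans lt.
  by rewrite enorm_distC; have := coord_le_enorm (y - x) j; rewrite !mxE.
apply: (@le_trans _ _ (n.+1%:R * n.+1%:R^-1)); first by rewrite divff// pnatr_eq0.
by apply: ler_pM => //; rewrite invr_ge0.
Qed.

End open_approximation.

(** A cutoff lies between the indicators of an erosion of [U] and of [U]; the erosions exhaust the
    mass of [U]. *)
Lemma lipschitz_open_le (m1 m2 : probability E R) (U : set E) : open U ->
  (forall k f, lipschitz_test k f ->
    (\int[m1]_x (f x)%:E = \int[m2]_x (f x)%:E)%E) -> (m1 U <= m2 U)%E.
Proof.
move=> oU h; have [UT|/set0P Uc] := eqVneq (~` U) set0.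
  by rewrite -[U]setCK UT setC0 !probability_setT.
have mU := open_measurable_rV oU.
apply/lee_addgt0Pr => e e0.
have mE n : measurable (erosion U n) by apply: closed_measurable_rV; exact: closed_erosion.
have [N] := measure_setD_bigcup_lt m1 e0 mE (@erosion_nd _ _ U).
rewrite bigcup_erosion// => hN.
have k0 : (0 : R) <= N.+1%:R by [].
pose f := cutoff U N.+1%:R; have lf : lipschitz_test N.+1%:R f by exact: cutoff_lipschitz.
have mf := lipschitz_test_measurable lf.
have f01 x : 0 <= f x <= 1 by case: lf.
have le1 : (m1 (erosion U N) <= m2 U)%E.
  have -> : m1 (erosion U N) = (\int[m1]_x (\1_(erosion U N) x)%:E)%E.
    by rewrite integral_indic// setIT.
  have -> : m2 U = (\int[m2]_x (\1_U x)%:E)%E by rewrite integral_indic// setIT.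
  apply: (@le_trans _ _ (\int[m1]_x (f x)%:E)%E).
    apply: ge0_le_integral => //; first exact/measurable_EFinP/measurable_indic.
    - exact/measurable_EFinP.
    - move=> x _; rewrite lee_fin indicE; case: (boolP (x \in _)) => [/set_mem ex|_].
        exact: cutoff_in ex.
      by case/andP: (f01 x).
  rewrite (h _ _ lf); apply: ge0_le_integral => //.
  - by move=> x _; rewrite lee_fin; case/andP: (f01 x).
  - exact/measurable_EFinP.
  - exact/measurable_EFinP/measurable_indic.
  - move=> x _; rewrite lee_fin indicE; case: (boolP (x \in _)) => [_|/negP nU].
      by case/andP: (f01 x).
    by rewrite /f cutoff_out// => Ux; apply: nU; exact/mem_set.
have -> : U = erosion U N `|` (U `\` erosion U N).
  by rewrite setDUK//; exact: erosion_sub.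
apply: (le_trans (measureU2 _ _ _)) => //; first exact: measurableD.
rewrite setDUK; last exact: erosion_sub.
by apply: leeD => //; exact: ltW.
Qed.

Lemma lipschitz_measure_eq (m1 m2 : probability E R) :
  (forall k f, lipschitz_test k f ->
    (\int[m1]_x (f x)%:E = \int[m2]_x (f x)%:E)%E) ->
  forall A, measurable A -> m1 A = m2 A.
Proof.
move=> h A mA.
apply: (@measure_unique _ _ _ (@open E) (fun=> setT)) => //.
- by move=> U V; exact: openI.
- by move=> _; exact: openT.
- by rewrite bigcup_const//; exists 0%N.
- move=> U oU; apply/eqP; rewrite eq_le !lipschitz_open_le// => k f lf.
  by rewrite (h _ _ lf).
- by move=> _; apply: (le_lt_trans (probability_le1 m1 (@measurableT _ E))); rewrite ltry.
Qed.

End lipschitz_tests.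

(** * First marginals of narrow limits *)

Section first_marginal_limit.
Variables (R : realType) (d : nat) (p : R).
Hypotheses (p2 : 2 <= p).
Local Notation E := 'rV[R]_d.

Let p0 : 0 < p. Proof. by move: p2; lra. Qed.

Lemma Wp_ge0 (mu nu : probability E R) : 0 <= Wp p mu nu.
Proof. exact: powR_ge0. Qed.

Lemma Wp_transport (mu nu : probability E R) (e : R) : Pp p mu -> Pp p nu ->
  0 < e -> Wp p mu nu <= e -> exists pi, [/\ coupling mu nu pi,
    forall pi', coupling mu nu pi' -> (cost p pi <= cost p pi')%E &
    (\int[pi]_z (enorm (z.1 - z.2) `^ p)%:E <= (e `^ p)%:E)%E].
Proof.
move=> hmu hnu e0 We; have [pi [cpi opt cE]] := Wp_optimal p2 hmu hnu.
exists pi; split => //; rewrite -[leLHS]/(cost p pi) cE lee_fin.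
by apply: ge0_ler_powR => //; rewrite ?nnegrE ?Wp_ge0// ltW.
Qed.

Lemma lipschitz_transport (mu nu : probability E R) (k e : R) (f : E -> R) :
  Pp p mu -> Pp p nu -> lipschitz_test k f -> 0 < e -> Wp p mu nu <= e ->
  `|\int[mu]_x f x - \int[nu]_x f x| <= k * (3 * e).
Proof.
move=> hmu hnu lf e0 We; have [pi [cpi _ ce]] := Wp_transport hmu hnu e0 We.
have mf := lipschitz_test_measurable lf.
have i1 := lipschitz_test_rintegrable mu lf.
have i2 := lipschitz_test_rintegrable nu lf.
have k0 : 0 <= k by case: lf.
rewrite (Rintegral_law measurable_fst cpi.1 mf i1).
rewrite (Rintegral_law measurable_snd cpi.2 mf i2).
have j1 := law_integrable measurable_fst cpi.1 mf i1.
have j2 := law_integrable measurable_snd cpi.2 mf i2.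
rewrite -RintegralB//.
have hH := displacement_pintegrable p2 measurable_fst measurable_snd cpi.1 cpi.2 hmu hnu.
have [mH iH] := pintegrable_sqintegrable p2 hH.
have hb := displacement_moment2 p2 measurable_fst measurable_snd cpi.1 cpi.2 hmu hnu e0 ce.
(* Bounds |h| by e + |h|^2 / e; as the mean of |h|^2 is at most 2 e^2, this integrates to at most 3
   k e. *)
pose u (z : E * E) := k * (e + e^-1 * dotp (z.2 - z.1) (z.2 - z.1)).
have iu0 : rintegrable pi (fun z : E * E => e + e^-1 * dotp (z.2 - z.1) (z.2 - z.1)).
  by apply: rintegrableD; [exact: rintegrable_cst|exact: rintegrableZ].
have iu : rintegrable pi u by exact: rintegrableZ.
have id : rintegrable pi (fun z : E * E => f z.1 - f z.2).
  exact: (integrableB _ j1 j2).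
apply: (@le_trans _ _ (\int[pi]_z u z)).
  apply: norm_rexp_le => // z; apply: (le_trans (lipschitz_test_dist _ _ lf)).
  rewrite ler_wpM2l// enorm_distC -enorm_sqr; set t := enorm _.
  have t0 : 0 <= t by exact: enorm_ge0.
  rewrite -(ler_pM2l e0) mulrDr mulrA divff ?gt_eqF// mul1r.
  have := sqr_ge0 (e - t); have -> : (e - t) ^+ 2 = e * e - 2 * (e * t) + t ^+ 2 by ring.
  have := mulr_ge0 (ltW e0) t0; lra.
rewrite rexpZ// ler_wpM2l// rexpD//; [|exact: rintegrable_cst|exact: rintegrableZ].
rewrite rexp_cst rexpZ//.
have : e^-1 * moment2 pi (fun z => z.2 - z.1) <= 2 * e.
  by rewrite ler_pdivrMl// mulrCA -expr2.
rewrite /moment2; lra.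
Qed.

(** The integrals of one Lipschitz test converge both to the value under [g], narrowly, and to the
    value under [mu], by transport; such tests separate measures. *)
Lemma first_marginal_limit (mus : nat -> probability E R)
    (gs : nat -> probability (E * E)%type R) (mu : probability E R)
    (g : probability (E * E)%type R) :
  (forall n, Pp p (mus n)) -> Pp p mu ->
  (forall n, first_marginal (gs n) (mus n)) ->
  (fun n => Wp p (mus n) mu) @ \oo --> 0 ->
  narrow_cvg gs g -> first_marginal g mu.
Proof.
move=> hmus hmu hgs W0 ncv.
have [g1 lg1] := image_law g (@measurable_fst _ _ E E).
suff eq1 A : measurable A -> g1 A = mu A by move=> A mA; rewrite lg1// eq1.
move: A; apply: lipschitz_measure_eq => k f lf.
have mf := lipschitz_test_measurable lf.
have f01 x : 0 <= f x <= 1 by case: lf.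
have k0 : 0 <= k by case: lf.
have mfE : measurable_fun setT (fun x => (f x)%:E) by exact/measurable_EFinP.
have f0 x : (0 <= (f x)%:E)%E by rewrite lee_fin; case/andP: (f01 x).
rewrite (ge0_integral_law measurable_fst lg1 mfE f0).
have c1 : (fun n => \int[gs n]_z (f z.1)%:E)%E @ \oo --> (\int[g]_z (f z.1)%:E)%E.
  apply: (ncv (fun z => f z.1)).
    have cf := lipschitz_test_continuous lf.
    by move=> z; apply: (@continuous_comp _ _ _ fst f); [exact: cvg_fst|exact: cf].
  by exists 1 => z; case/andP: (f01 z.1) => h1 h2; rewrite ger0_norm.
have c2 : (fun n => \int[gs n]_z (f z.1)%:E)%E @ \oo --> (\int[mu]_x (f x)%:E)%E.
  have -> : (fun n => \int[gs n]_z (f z.1)%:E)%E = (fun n => (\int[mus n]_x f x)%:E).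
    apply/funext => n; rewrite -rexp_EFin; last exact: lipschitz_test_rintegrable lf.
    by rewrite (ge0_integral_law measurable_fst (hgs n) mfE f0).
  rewrite rexp_EFin; last exact: lipschitz_test_rintegrable lf.
  apply: cvg_EFin; first exact: nearW.
  apply/cvgrPdist_le => eps eps0.
  pose e := eps / (3 * k + 1).
  have k1 : 0 < 3 * k + 1 by rewrite ltr_wpDl// mulr_ge0.
  have e0 : 0 < e by rewrite divr_gt0.
  have We : \forall n \near \oo, Wp p (mus n) mu < e by apply: cvgr_lt W0 _ _.
  apply: filterS We => n Wn.
  rewrite distrC; apply: (le_trans (lipschitz_transport (hmus n) hmu lf e0 (ltW Wn))).
  rewrite mulrA (mulrC k) /e mulrCA ger_pMr// ler_pdivrMr// mul1r lerDl//.
exact: (cvg_unique _ c1 c2).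
Qed.

End first_marginal_limit.

(** * Continuity of TP, limits of graphs, and the extended subdifferential *)

Section regularity_of_TP.
Variables (R : realType) (d : nat) (p : R).
Hypotheses (p2 : 2 <= p) (d_gt0 : (0 < d)%N).
Local Notation E := 'rV[R]_d.

Let p0 : 0 < p. Proof. by move: p2; lra. Qed.

Definition cov_modulus (mu : probability E R) : R :=
  2 * Num.sqrt (2 * moment2 mu id) + 2.

Lemma cov_modulus_ge0 mu : 0 <= cov_modulus mu.
Proof. by rewrite addr_ge0// mulr_ge0// sqrtr_ge0. Qed.

Lemma covmx_near_r (mu nu : probability E R) (e : R) i j : Pp p mu -> Pp p nu ->
  0 < e -> e <= 1 -> Wp p mu nu <= e ->
  `|covmx nu i j - covmx mu i j| <= cov_modulus mu * e.
Proof.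
move=> hmu hnu e0 e1 /(Wp_transport p2 hmu hnu e0)[pi [cpi _ ce]].
exact: (covmx_transport p2 measurable_fst measurable_snd cpi.1 cpi.2 hmu hnu e0 ce).
Qed.

(** [Wp] occurs in both orders: semicontinuity measures from [mu], the given sequence towards [mu].
    Exchanging the projections of the plan covers the second order while the modulus remains that of
    the fixed measure [mu]. *)
Lemma covmx_near_l (mu nu : probability E R) (e : R) i j : Pp p mu -> Pp p nu ->
  0 < e -> e <= 1 -> Wp p nu mu <= e ->
  `|covmx nu i j - covmx mu i j| <= cov_modulus mu * e.
Proof.
move=> hmu hnu e0 e1 /(Wp_transport p2 hnu hmu e0)[pi [cpi _ ce]].
have ce' : (\int[pi]_z (enorm (z.2 - z.1) `^ p)%:E <= (e `^ p)%:E)%E.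
  have -> : (fun z : E * E => (enorm (z.2 - z.1) `^ p)%:E) =
            (fun z : E * E => (enorm (z.1 - z.2) `^ p)%:E).
    by apply/funext => z; rewrite (enorm_distC z.2).
  exact: ce.
exact: (covmx_transport p2 measurable_snd measurable_fst cpi.2 cpi.1 hmu hnu e0 ce').
Qed.

Lemma covmx_le (mu : probability E R) i j : Pp p mu ->
  `|covmx mu i j| <= moment2 mu id.
Proof.
move=> /(Pp_sqintegrable p2) hmu; apply: (le_trans (crossmx_le _ _ hmu hmu)).
by rewrite -expr2 sqrtr_sqr ger0_norm// moment2_ge0.
Qed.

Definition TP_modulus (mu : probability E R) : R := d%:R ^+ 2 *
  (4 * (moment2 mu id * cov_modulus mu) + 2 * cov_modulus mu ^+ 2).

Lemma TP_modulus_ge0 mu : 0 <= TP_modulus mu.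
Proof.
have K0 := cov_modulus_ge0 mu; have a0 := moment2_ge0 mu id.
apply: mulr_ge0; first exact: sqr_ge0.
by rewrite addr_ge0// mulr_ge0// ?sqr_ge0// mulr_ge0.
Qed.

Lemma TPr_near (mu nu : probability E R) (e : R) : Pp p mu -> 0 < e -> e <= 1 ->
  (forall i j, `|covmx nu i j - covmx mu i j| <= cov_modulus mu * e) ->
  `|TPr nu - TPr mu| <= TP_modulus mu * e.
Proof.
move=> hmu e0 e1 h; have K0 := cov_modulus_ge0 mu.
set K := cov_modulus mu in h K0 *.
pose D := covmx nu - covmx mu.
have hD i j : `|D i j| <= K * e by rewrite [D _ _]mxE [X in _ + X]mxE; exact: h.
have -> : TPr nu - TPr mu = 2 * tpform (covmx mu) D + tpform D D.
  have nuE : covmx nu = covmx mu + D by rewrite /D addrC subrK.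
  rewrite /TPr nuE; move: D {hD nuE} => D.
  rewrite tpformDl !tpformDr (tpformC D (covmx mu)); ring.
have h1 := tpform_le d_gt0 (fun i j => covmx_le i j hmu) hD.
have h2 := tpform_le d_gt0 hD hD.
apply: (le_trans (ler_normD _ _)); rewrite normrM ger0_norm//.
have ee : e * e <= e by rewrite ger_pMr.
have h3 : 2 * d%:R ^+ 2 * (K * e * (K * e)) <= d%:R ^+ 2 * (2 * K ^+ 2) * e.
  have -> : 2 * d%:R ^+ 2 * (K * e * (K * e)) = d%:R ^+ 2 * (2 * K ^+ 2) * (e * e) by ring.
  by rewrite ler_wpM2l// mulr_ge0 ?sqr_ge0// mulr_ge0 ?sqr_ge0.
rewrite /TP_modulus -/K.
have -> : d%:R ^+ 2 * (4 * (moment2 mu id * K) + 2 * K ^+ 2) * e =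
  2 * (2 * d%:R ^+ 2 * (moment2 mu id * (K * e))) + d%:R ^+ 2 * (2 * K ^+ 2) * e by ring.
apply: lerD; first by rewrite ler_wpM2l.
exact: le_trans h2 h3.
Qed.

Lemma TP_E (mu : probability E R) : Pp p mu -> TP mu = (TPr mu)%:E.
Proof. by move=> hmu; exact: TP_tpform (Pp_sqintegrable p2 hmu). Qed.

Lemma Pp_dirac0 : Pp p (\d_(0 : E) : probability E R).
Proof.
rewrite /Pp integral_dirac//; last first.
  by apply/measurable_EFinP; apply: measurable_enorm_powR; exact: measurable_id.
by rewrite diracT mul1e ltry.
Qed.

Lemma TP_proper_lsc : proper_lsc p (@TP R d).
Proof.
split; first by move=> mu hmu; rewrite TP_E// ltNyr.
split.
  by exists (\d_(0 : E) : probability E R); split; [exact: Pp_dirac0|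
    rewrite (TP_E Pp_dirac0) ltry].
move=> mu hmu a; rewrite TP_E// lte_fin => a_lt.
have L0 := TP_modulus_ge0 mu; set L := TP_modulus mu in L0.
have L1 : 0 < L + 1 by rewrite ltr_wpDl.
(* Makes the variation of TP at most half of the gap between [TPr mu] and [a]. *)
pose e := Num.min 1 ((TPr mu - a) / (2 * (L + 1))).
have gap0 : 0 < TPr mu - a by rewrite subr_gt0.
have e0 : 0 < e by rewrite /e lt_min ltr01 divr_gt0// mulr_gt0.
have e1 : e <= 1 by rewrite /e ge_min lexx.
have Le : L * e < TPr mu - a.
  apply: (@le_lt_trans _ _ ((L + 1) * ((TPr mu - a) / (2 * (L + 1))))).
    apply: ler_pM => //; [exact: ltW|by rewrite lerDl|by rewrite /e ge_min lexx orbT].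
  have -> : (L + 1) * ((TPr mu - a) / (2 * (L + 1))) = (TPr mu - a) / 2.
    by field; rewrite gt_eqF.
  by rewrite ltr_pdivrMr// ltr_pMr// ltr1n.
exists e; split => // nu hnu /ltW We; rewrite TP_E// lte_fin.
have := TPr_near hmu e0 e1 (fun i j => covmx_near_r i j hmu hnu e0 e1 We).
rewrite -/L ler_norml => /andP[h _]; move: h Le; lra.
Qed.

Lemma continuous_defect (A : 'M[R]_d) : continuous (defect A).
Proof.
have cw i : continuous (fun z : E * E => (z.2 - z.1 *m A) ord0 i).
  have -> : (fun z : E * E => (z.2 - z.1 *m A) ord0 i) =
    (fun z => z.2 ord0 i - \sum_j z.1 ord0 j * A j i).
    by apply/funext => z; rewrite mxE [X in _ + X]mxE [X in _ - X]mxE.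
  move=> z; have FFz : Filter (nbhs z) by exact: nbhs_filter.
  apply: cvgB.
    apply: (@continuous_comp _ _ _ snd (fun v : E => v ord0 i)); first exact: cvg_snd.
    exact: coord_continuous.
  apply: cvg_big => [|j _]; first exact: add_continuous.
  apply: cvgM; last exact: cvg_cst.
  apply: (@continuous_comp _ _ _ fst (fun v : E => v ord0 j)); first exact: cvg_fst.
  exact: coord_continuous.
have cs : continuous (fun z : E * E => dotp (z.2 - z.1 *m A) (z.2 - z.1 *m A)).
  move=> z; have FFz : Filter (nbhs z) by exact: nbhs_filter.
  apply: cvg_big => [|j _]; first exact: add_continuous.
  by apply: cvgM; exact: cw.
move=> z; have FFz : Filter (nbhs z) by exact: nbhs_filter.
apply: cvgM; first exact: cs.
apply: cvgV; first by rewrite gt_eqF// ltr_wpDr// dotp_ge0.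
by apply: cvgD; [exact: cvg_cst|exact: cs].
Qed.

(** Each of the d coordinates is at most d |x| beta in absolute value, which gives the cube of d
    after squaring and summing. *)
Lemma dotp_mulmx_le (x : E) (B : 'M[R]_d) (beta : R) :
  (forall i j, `|B i j| <= beta) ->
  dotp (x *m B) (x *m B) <= d%:R ^+ 3 * beta ^+ 2 * dotp x x.
Proof.
move=> hB.
have i0 : 'I_d by exact: Ordinal d_gt0.
have b0 : 0 <= beta by exact: le_trans (hB i0 i0).
have h j : `|(x *m B) ord0 j| <= d%:R * (enorm x * beta).
  rewrite mxE; apply: (le_trans (ler_norm_sum _ _ _)).
  have -> : d%:R * (enorm x * beta) = \sum_(i < d) enorm x * beta.
    by rewrite sumr_const card_ord mulr_natl.
  by apply: ler_sum => i _; rewrite normrM ler_pM// coord_le_enorm.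
have -> : d%:R ^+ 3 * beta ^+ 2 * dotp x x = \sum_(j < d) (d%:R * (enorm x * beta)) ^+ 2.
  by rewrite sumr_const card_ord -enorm_sqr -mulr_natl; ring.
apply: ler_sum => j _; rewrite -expr2 -[leLHS]real_normK ?num_real//.
by rewrite ler_pXn2r// nnegrE// mulr_ge0// mulr_ge0// enorm_ge0.
Qed.

(** Trading one matrix for another costs a multiple of |x1|^2, so the error is controlled by the
    first marginal without any second moment of [x2]. *)
Lemma defect_change (A B : 'M[R]_d) (beta : R) (z : E * E) :
  (forall i j, `|(B - A) i j| <= beta) ->
  defect A z <= 2 * defect B z + 2 * (d%:R ^+ 3 * beta ^+ 2) * dotp z.1 z.1.
Proof.
move=> hAB.
have wE : z.2 - z.1 *m A = (z.2 - z.1 *m B) + z.1 *m (B - A).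
  by rewrite mulmxBr addrA subrK.
set s := dotp (z.2 - z.1 *m B) (z.2 - z.1 *m B).
set v := dotp (z.1 *m (B - A)) (z.1 *m (B - A)).
have s0 : 0 <= s by exact: dotp_ge0.
have v0 : 0 <= v by exact: dotp_ge0.
apply: (@le_trans _ _ (sat (2 * s + 2 * v))).
  by apply: sat_le; [exact: dotp_ge0|rewrite wE; exact: dotpDD_le].
apply: (le_trans (satD_le s0 _)); first by rewrite mulr_ge0.
by rewrite lerD2l -mulrA ler_wpM2l//; exact: dotp_mulmx_le.
Qed.

Let scalar_mxB (x y : R) : ((x - y)%:M : 'M[R]_d) = x%:M - y%:M.
Proof. exact: raddfB. Qed.

Lemma tpgrad_near (S M : 'M[R]_d) (u : R) i j :
  (forall i j, `|S i j - M i j| <= u) -> `|(tpgrad S - tpgrad M) i j| <= 8 * u.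
Proof.
move=> h; pose D := S - M.
have hD i' j' : `|D i' j'| <= u by rewrite [D _ _]mxE [X in _ + X]mxE; exact: h.
have -> : tpgrad S - tpgrad M = 4 *: (D - (d%:R^-1 * \tr D)%:M).
  rewrite /tpgrad -scalerBr; congr (_ *: _).
  have -> : \tr D = \tr S - \tr M by rewrite /D linearB.
  rewrite mulrBr scalar_mxB /D !opprB addrACA [RHS]addrACA.
  by congr (_ + _); exact: addrC.
have u0 : 0 <= u by exact: le_trans (hD i j).
have trD : `|d%:R^-1 * \tr D| <= u.
  rewrite normrM ger0_norm ?invr_ge0// ler_pdivrMl ?ltr0n//.
  apply: (le_trans (ler_norm_sum _ _ _)).
  have -> : d%:R * u = \sum_(i < d) u by rewrite sumr_const card_ord mulr_natl.
  exact: ler_sum.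
rewrite mxE [X in _ * X]mxE [X in _ * (_ + X)]mxE [X in _ * (_ - X)]mxE.
rewrite normrM ger0_norm//; have -> : 8 * u = 4 * (u + u) by ring.
rewrite ler_wpM2l//; apply: (le_trans (ler_normB _ _)); rewrite lerD//.
by case: (i == j); rewrite ?mulr1n// mulr0n normr0.
Qed.

Lemma moment2_covmx (mu : probability E R) : Pp p mu ->
  moment2 mu id = \sum_i covmx mu i i.
Proof.
move=> /(Pp_sqintegrable p2) hmu; rewrite /moment2 /dotp rexp_sum.
  by apply: eq_bigr => i _; rewrite mxE.
by move=> i; exact: (rintegrable_coordM i i hmu hmu).
Qed.

Lemma graph_limit (mus : nat -> probability E R)
    (gs : nat -> probability (E * E)%type R) (mu : probability E R)
    (g : probability (E * E)%type R) :
  (forall n, Pp p (mus n)) -> Pp p mu ->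
  (forall n, first_marginal (gs n) (mus n)) ->
  (forall n, \int[gs n]_z defect (tpgrad (covmx (mus n))) z = 0) ->
  (fun n => Wp p (mus n) mu) @ \oo --> 0 ->
  narrow_cvg gs g -> \int[g]_z defect (tpgrad (covmx mu)) z = 0.
Proof.
move=> hmus hmu hgs h0 W0 ncv; set A := tpgrad (covmx mu).
pose K := cov_modulus mu; have K0 : 0 <= K by exact: cov_modulus_ge0.
pose a := moment2 mu id; have a0 : 0 <= a by exact: moment2_ge0.
(* Obtained from [defect_change] with matrices [8 * K * e] apart and second moments at most
   [a + d%:R * K]; the square of [e] is then bounded by [e]. *)
pose C := 2 * (d%:R ^+ 3 * (8 * K) ^+ 2) * (a + d%:R * K).
have C0 : 0 <= C.
  by rewrite !mulr_ge0// ?exprn_ge0// ?addr_ge0// ?mulr_ge0.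
have key n e : 0 < e -> e <= 1 -> Wp p (mus n) mu <= e ->
    \int[gs n]_z defect A z <= C * e.
  move=> e0 e1 We.
  have hcov i j := covmx_near_l i j hmu (hmus n) e0 e1 We.
  have hA i j := tpgrad_near i j hcov.
  have ifst := law_integrable measurable_fst (hgs n) _ (Pp_sqintegrable p2 (hmus n)).2.
  have {ifst} : rintegrable (gs n) (fun z : E * E => dotp z.1 z.1).
    by apply: ifst; apply: measurable_dotp; exact: measurable_id.
  move=> ifst.
  have m2 : \int[gs n]_z dotp z.1 z.1 = moment2 (mus n) id.
    exact: (moment2_law measurable_fst (hgs n) (Pp_sqintegrable p2 (hmus n))).
  have m2le : moment2 (mus n) id <= a + d%:R * K.
    rewrite /a !moment2_covmx//.
    have -> : d%:R * K = \sum_(i < d) K by rewrite sumr_const card_ord mulr_natl.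
    rewrite -big_split; apply: ler_sum => i _; rewrite -lerBlDl.
    apply: (le_trans (ler_norm _)); apply: (le_trans (hcov i i)).
    by rewrite ler_piMr.
  apply: (@le_trans _ _ (\int[gs n]_z (2 * defect (tpgrad (covmx (mus n))) z +
      2 * (d%:R ^+ 3 * (8 * (K * e)) ^+ 2) * dotp z.1 z.1))).
    apply: le_rexp; first exact: rintegrable_defect.
      by apply: rintegrableD; [apply: rintegrableZ; exact: rintegrable_defect|exact: rintegrableZ].
    by move=> z; exact: defect_change.
  rewrite rexpD; [|apply: rintegrableZ; exact: rintegrable_defect|exact: rintegrableZ].
  rewrite !rexpZ//; last exact: rintegrable_defect.
  rewrite h0 mulr0 add0r m2.
  apply: (@le_trans _ _ (2 * (d%:R ^+ 3 * (8 * (K * e)) ^+ 2) * (a + d%:R * K))).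
    apply: ler_wpM2l m2le; apply: mulr_ge0 => //.
    by apply: mulr_ge0; [exact: exprn_ge0|exact: sqr_ge0].
  have -> : 2 * (d%:R ^+ 3 * (8 * (K * e)) ^+ 2) * (a + d%:R * K) = C * (e * e).
    by rewrite /C; ring.
  by rewrite ler_wpM2l// ger_pMr.
have c1 : (fun n => \int[gs n]_z (defect A z)%:E)%E @ \oo --> (\int[g]_z (defect A z)%:E)%E.
  apply: (ncv (defect A)); first exact: continuous_defect.
  by exists 1 => z; rewrite ger0_norm ?defect_ge0// defect_le1.
have c2 : (fun n => \int[gs n]_z (defect A z)%:E)%E @ \oo --> (0 : R)%:E.
  have -> : (fun n => \int[gs n]_z (defect A z)%:E)%E =
      (fun n => (\int[gs n]_z defect A z)%:E).
    by apply/funext => n; rewrite -rexp_EFin//; exact: rintegrable_defect.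
  apply: cvg_EFin; first exact: nearW.
  apply/cvgrPdist_le => eps eps0.
  have C1 : 0 < C + 1 by rewrite ltr_wpDl.
  pose e := Num.min 1 (eps / (C + 1)).
  have e0 : 0 < e by rewrite /e lt_min ltr01 divr_gt0.
  have We : \forall n \near \oo, Wp p (mus n) mu < e by apply: cvgr_lt W0 _ _.
  apply: filterS We => n Wn.
  rewrite sub0r normrN ger0_norm; last by apply: rexp_ge0 => z; exact: defect_ge0.
  apply: (le_trans (key n e e0 _ (ltW Wn))); first by rewrite /e ge_min lexx.
  apply: (@le_trans _ _ (C * (eps / (C + 1)))).
    by rewrite ler_wpM2l// /e ge_min lexx orbT.
  by rewrite mulrCA ger_pMr// ler_pdivrMr// mul1r lerDl.
have lim0 : (\int[g]_z (defect A z)%:E)%E = 0%:E by exact: (cvg_unique _ c1 c2).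
by rewrite /Rintegral lim0.
Qed.

Lemma measurable_graph (A : 'M[R]_d) : measurable_fun setT (fun x : E => (x, x *m A)).
Proof.
apply: measurable_fun_pair; first exact: measurable_id.
by apply: measurable_mulmx; exact: measurable_id.
Qed.

(** A nonnegative defect of zero mean vanishes off a null set, where [x2 = x1 A]. The plan is then
    determined by its first marginal. *)
Lemma graph_law (mu : probability E R) (g : probability (E * E)%type R) (A : 'M[R]_d) :
  first_marginal g mu -> \int[g]_z defect A z = 0 ->
  has_law mu g (fun x : E => (x, x *m A)).
Proof.
move=> hg h0.
have : (\int[g]_z `|(defect A z)%:E| = 0)%E.
  under eq_integral do rewrite gee0_abs ?lee_fin ?defect_ge0//.
  by rewrite rexp_EFin ?h0//; exact: rintegrable_defect.
move=> /ae_eq_integral_abs => /(_ measurableT).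
have mdE : measurable_fun setT (fun z : E * E => (defect A z)%:E).
  by apply/measurable_EFinP; exact: measurable_defect.
move=> /(_ mdE) [N [mN N0 hN]].
have {}N0 : g N = 0%E by exact: N0.
have offN z : ~ N z -> z.2 = z.1 *m A.
  move=> nN; apply/eqP; rewrite -subr_eq0; apply/eqP/dotp_eq0.
  have : defect A z = 0.
    by apply: contrapT => dz; apply: nN; apply: hN => /= h; apply: dz; have := h I => -[].
  rewrite /defect /sat => /eqP; rewrite mulf_eq0 invr_eq0 => /orP[/eqP//|].
  by rewrite gt_eqF// ltr_wpDr// dotp_ge0.
(* [C'] tests [(z.1, z.1 *m A)] in place of [z]; it differs from [C] only within the null set
   [N]. *)
move=> C mC; pose C' : set (E * E) := fst @^-1` ((fun x : E => (x, x *m A)) @^-1` C).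
have mG : measurable ((fun x : E => (x, x *m A)) @^-1` C).
  by rewrite -[X in measurable X]setTI; exact: measurable_graph.
have mC' : measurable C' by rewrite -[C']setTI; exact: measurable_fst.
rewrite -hg// -/C'; have leN (B1 B2 : set (E * E)) : measurable B1 -> measurable B2 ->
    B1 `<=` B2 `|` N -> (g B1 <= g B2)%E.
  move=> mB1 mB2 sub; apply: (@le_trans _ _ (g (B2 `|` N))).
    by apply: le_measure; rewrite ?inE//; exact: measurableU.
  have gU : (g (B2 `|` N) <= g B2 + g N)%E by exact: measureU2.
  by apply: (le_trans gU); rewrite N0 adde0.
have zE z : ~ N z -> z = (z.1, z.1 *m A) by move=> /offN <-; case: z.
apply/eqP; rewrite eq_le; apply/andP; split; apply: leN => // z hz.
  by have [Nz|nN] := pselect (N z); [right|left; rewrite (zE z nN)].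
by have [Nz|nN] := pselect (N z); [right|left; rewrite /C'/= -(zE z nN)].
Qed.

Lemma TP_ext_frechet (mu : probability E R) (g : probability (E * E)%type R) :
  Pp p mu -> first_marginal g mu ->
  \int[g]_z defect (tpgrad (covmx mu)) z = 0 ->
  ext_frechet_subdiff p (@TP R d) mu g.
Proof.
move=> hmu hg h0; set A := tpgrad (covmx mu) in h0.
have lg := graph_law hg h0.
have hsq := Pp_sqintegrable p2 hmu.
have mid : measurable_fun setT (@id E) by exact: measurable_id.
split => //; split; first by rewrite TP_E// ltry.
split.
  split.
    rewrite /mom1 -(ge0_integral_law (measurable_fst) hg
      (g := fun x : E => (enorm x `^ p)%:E))//.
      by apply/measurable_EFinP; exact: measurable_enorm_powR.
    by move=> x; rewrite lee_fin powR_ge0.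
  rewrite /mom2 (ge0_integral_law (measurable_graph A) lg)/=; last 2 first.
    by apply/measurable_EFinP; apply: measurable_enorm_powR; exact: measurable_snd.
    by move=> z; rewrite lee_fin powR_ge0.
  have iA : rintegrable mu (fun x => dotp (x *m A) (x *m A)).
    have [beta hb] : exists beta, forall i j, `|A i j| <= beta.
      exists (\sum_i \sum_j `|A i j|) => i j.
      rewrite (bigD1 i)//= (bigD1 j)//= -addrA lerDl addr_ge0//.
        exact: sumr_ge0.
      by apply: sumr_ge0 => k _; exact: sumr_ge0.
    apply: (rintegrable_le _ (rintegrableZ (d%:R ^+ 3 * beta ^+ 2) hsq.2)) => [|x].
      by apply: measurable_dotp; exact: measurable_mulmx.
    by rewrite ger0_norm ?dotp_ge0//; exact: dotp_mulmx_le.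
  have iq : rintegrable mu (fun x => enorm (x *m A) `^ conj_exp p).
    apply: (rintegrable_le _ (rintegrableD (rintegrable_cst mu 1) iA)) => [|x].
      by apply: measurable_enorm_powR; exact: measurable_mulmx.
    have /andP[q1 q2] := conj_exp_bounds p2.
    rewrite ger0_norm ?powR_ge0// -enorm_sqr; set t := enorm _.
    have t0 : 0 <= t by exact: enorm_ge0.
    have [le1|/ltW ge1] := leP t 1.
      apply: (@le_trans _ _ 1); last by rewrite lerDl sqr_ge0.
      apply: (@le_trans _ _ (1 `^ conj_exp p)); last by rewrite powR1.
      apply: ge0_ler_powR; rewrite ?nnegrE//.
      exact: le_trans q1.
    by rewrite -powR_mulrn// (le_trans (ler_powR ge1 q2))// lerDr.
  by rewrite rexp_EFin// ltry.
split => // eps eps0.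
pose a := moment2 mu id; have a0 : 0 <= a by exact: moment2_ge0.
pose K := d%:R ^+ 2 * (40 * a + 16).
have K0 : 0 <= K.
  by apply: mulr_ge0; [exact: sqr_ge0|rewrite addr_ge0// mulr_ge0].
have K1 : 0 < K + 1 by rewrite ltr_wpDl.
pose delta := Num.min 1 (eps / (K + 1)).
have delta0 : 0 < delta by rewrite /delta lt_min ltr01 divr_gt0.
exists delta; split => // nu hnu Wd.
have W0 := Wp_ge0 p mu nu.
have [pi [cpi opt cE]] := Wp_optimal p2 hmu hnu.
(* Since [x2] is a function of [x1] under [g], inserting [x1 A] into an optimal plan from [mu] to
   [nu] gives an element of [Gamma0] without any gluing. *)
have mf : measurable_fun setT (fun z : E * E => ((z.1, z.1 *m A), z.2)).
  apply: measurable_fun_pair; last exact: measurable_snd.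
  exact: (measurableT_comp (measurable_graph A) measurable_fst).
have [b lb] := image_law pi mf.
have Gb : Gamma0 p mu g nu b.
  split.
    split=> [C mC|C mC].
      rewrite -lb; last by rewrite -[X in measurable X]setTI; exact: measurable_fst.
      rewrite -lg//; apply: cpi.1.
      by rewrite -[X in measurable X]setTI; exact: measurable_graph.
    rewrite -lb; last by rewrite -[X in measurable X]setTI; exact: measurable_snd.
    exact: cpi.2.
  move=> pi' /opt; apply: le_trans.
  rewrite /cost13 (ge0_integral_law mf lb)//.
    apply/measurable_EFinP; apply: measurable_enorm_powR; apply: measurable_rVB.
      exact: (measurableT_comp measurable_fst measurable_fst).
    exact: measurable_snd.
  by move=> x; rewrite lee_fin powR_ge0.
have expansion e : 0 < e -> Wp p mu nu <= e ->
    rintegrable pi (fun z : E * E => dotp (z.1 *m A) (z.2 - z.1)) /\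
    `|TPr nu - TPr mu - \int[pi]_z dotp (z.1 *m A) (z.2 - z.1)| <=
      d%:R ^+ 2 * (40 * moment2 mu id * e ^+ 2 + 16 * e ^+ 4).
  move=> e0 We.
  have ce : (\int[pi]_z (enorm (z.1 - z.2) `^ p)%:E <= (e `^ p)%:E)%E.
    rewrite -[leLHS]/(cost p pi) cE lee_fin.
    by apply: ge0_ler_powR => //; rewrite ?nnegrE// ltW.
  exact: (TP_expansion p2 d_gt0 measurable_fst measurable_snd cpi.1 cpi.2 hmu hnu e0 ce).
have [iP _] := expansion delta delta0 (ltW Wd).
have mP : measurable_fun setT (fun x : (E * E) * E => dotp x.1.2 (x.2 - x.1.1)).
  apply: measurable_dotp.
    exact: (measurableT_comp measurable_snd measurable_fst).
  apply: measurable_rVB; first exact: measurable_snd.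
  exact: (measurableT_comp measurable_fst measurable_fst).
have pE : pairing b = (\int[pi]_z dotp (z.1 *m A) (z.2 - z.1))%:E.
  rewrite /pairing -rexp_EFin// (integral_law mf lb mP)//.
  exact: (integrable_law mf lb mP iP).
(* The infimum sits on the smaller side, so one competitor is enough. *)
apply: (@le_trans _ _ (pairing b - (eps * Wp p mu nu)%:E)%E).
  by apply: leeB => //; apply: ereal_inf_lbound; exists b.
rewrite pE !TP_E// -!EFinB lee_fin.
(* The estimate is applied at scales e slightly above W_p(mu, nu), which may vanish. *)
apply/ler_addgt0Pr => eta eta0.
pose e := Num.min delta (Wp p mu nu + eta / eps).
have e0 : 0 < e by rewrite /e lt_min delta0/= ltr_wpDl// divr_gt0.
have We : Wp p mu nu <= e by rewrite /e le_min (ltW Wd)/= lerDl divr_ge0 ?ltW.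
have [_ ] := expansion e e0 We.
rewrite -/a ler_norml => /andP[h _].
have e1 : e <= 1 by rewrite /e /delta !ge_min lexx.
have e4 : e ^+ 4 <= e ^+ 2 by rewrite ler_wiXn2l// ltW.
have Ke : K * e <= eps.
  apply: (@le_trans _ _ (K * (eps / (K + 1)))).
    by rewrite ler_wpM2l// /e /delta !ge_min lexx !orbT.
  by rewrite mulrCA ger_pMr// ler_pdivrMr// mul1r lerDl.
have h1 : d%:R ^+ 2 * (40 * a * e ^+ 2 + 16 * e ^+ 4) <= K * e * e.
  have -> : K * e * e = d%:R ^+ 2 * (40 * a * e ^+ 2 + 16 * e ^+ 2) by rewrite /K; ring.
  by rewrite ler_wpM2l ?sqr_ge0// lerD2l ler_wpM2l.
have h2 : K * e * e <= eps * e by rewrite ler_wpM2r// ltW.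
have h3 : eps * e <= eps * Wp p mu nu + eta.
  apply: (@le_trans _ _ (eps * (Wp p mu nu + eta / eps))).
    apply: ler_wpM2l; first exact: ltW.
    by rewrite /e ge_min lexx orbT.
  by rewrite mulrDr mulrCA divff ?gt_eqF// mulr1.
move: h h1 h2 h3; set I1 := \int[pi]_z _; set r1 := d%:R ^+ 2 * _; lra.
Qed.

End regularity_of_TP.
Theorem mainTheorem8 (R : realType) (d : nat) (p : R) (hd : (0 < d)%N) (hp : 2 <= p) :
  regular p (@TP R d).
Proof.
split; first exact: TP_proper_lsc hp hd.
move=> mus gs mu g vphi hgs TPmus hmus hmu W0 _ ncv.
have hfm n : first_marginal (gs n) (mus n) by case: (hgs n) => _ [_ [_ []]].
have hgr n := strong_subdiff_graph hp hd (hgs n).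
have fm := first_marginal_limit hp hmus hmu hfm W0 ncv.
have gr := graph_limit hp hd hmus hmu hfm hgr W0 ncv.
split; first exact: TP_ext_frechet.
(* TP is continuous for [Wp], not merely lower semicontinuous, so the limit of the values is
   identified by uniqueness. *)
suff TPmu : (fun n => TP (mus n)) @ \oo --> TP mu by exact: (cvg_unique _ TPmus TPmu).
have -> : (fun n => TP (mus n)) = (fun n => (TPr (mus n))%:E).
  by apply/funext => n; rewrite (TP_E hp).
rewrite (TP_E hp hmu); apply: cvg_EFin; first exact: nearW.
apply/cvgrPdist_le => eps eps0.
have L0 := TP_modulus_ge0 mu; set L := TP_modulus mu in L0.
have L1 : 0 < L + 1 by rewrite ltr_wpDl.
pose e := Num.min 1 (eps / (L + 1)).
have e0 : 0 < e by rewrite /e lt_min ltr01 divr_gt0.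
have e1 : e <= 1 by rewrite /e ge_min lexx.
have We : \forall n \near \oo, Wp p (mus n) mu < e by apply: cvgr_lt W0 _ _.
apply: filterS We => n /ltW Wn; rewrite distrC.
apply: (le_trans (TPr_near hp hd hmu e0 e1
  (fun i j => covmx_near_l hp i j hmu (hmus n) e0 e1 Wn))).
rewrite -/L; apply: (@le_trans _ _ (L * (eps / (L + 1)))).
  by rewrite ler_wpM2l// /e ge_min lexx orbT.
by rewrite mulrCA ger_pMr// ler_pdivrMr// mul1r lerDl.
Qed.
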